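(* Suppose $\mathfrak p=1$, i.e. $\phi(\{0\})=0$. Then $\mathbf E|\overline\xi_1|<\infty$ if and only if $$\int_{(0,\infty)}|\log y|\,\phi(dy)<\infty .$$ In this case $$\mathbf E[\overline\xi_1]=i\,\overline\Psi'(0)=\Gamma(\alpha)\frac{\sin(\pi\alpha\widehat\rho)}{\pi}\left(\pi\cot(\pi\alpha\widehat\rho)+\int_{(0,\infty)}(\log y)\,\phi(dy)\right).$$
   Context: Parameters: $(\alpha,\rho)$ is a permissible pair, meaning $\alpha\in(0,1),\rho\in(0,1)$; or $\alpha\in(1,2),\rho\in(1-1/\alpha,1/\alpha)$; or $(\alpha,\rho)=(1,1/2)$. Put $\widehat\rho=1-\rho$ and $c_-=\dfrac{\Gamma(\alpha+1)}{\Gamma(\alpha\widehat\rho)\Gamma(1-\alpha\widehat\rho)}$. (This is the constant for which the strictly $\alpha$-stable process $\eta$ with positivity parameter $\rho=\mathbb P(\eta_1>0)$ has Lévy density $c_+x^{-1-\alpha}\mathbf 1_{(x>0)}+c_-|x|^{-1-\alpha}\mathbf 1_{(x<0)}$, with $c_+=\Gamma(\alpha+1)/(\Gamma(\alpha\rho)\Gamma(1-\alpha\rho))$.) Return and resurrection kernels: $\phi$ is a Borel probability measure on $[0,\infty)$; $p(z,A)=\phi(|z|^{-1}A)$ for $z<0$ and Borel $A\subset[0,\infty)$; $\mathfrak p=1-\phi(\{0\})$; for $x>0$ and Borel $A\subset(0,\infty)$, $q(x,A)=\int_{-\infty}^0 c_-(x-z)^{-1-\alpha}p(z,A)\,dz$.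 The finite measure $q(x,\cdot)$ on $(0,\infty)$ has total mass $\mathfrak p\,c_-\alpha^{-1}x^{-\alpha}$. The process $\overline\xi$: under $\mathbf P$ (expectation $\mathbf E$), $\overline\xi$ is the Lévy process started at $0$ with $\mathbf E[e^{i\theta\overline\xi_t}]=e^{-t\overline\Psi(\theta)}$, where $$\overline\Psi(\theta)=\frac{\Gamma(\alpha-i\theta)}{\Gamma(\alpha\widehat\rho-i\theta)}\frac{\Gamma(1+i\theta)}{\Gamma(1-\alpha\widehat\rho+i\theta)}-\int_{(0,\infty)}y^{i\theta}\,q(1,dy),\qquad\theta\in\mathbb R .$$ It is killed at rate $\overline\Psi(0)=(1-\mathfrak p)c_-/\alpha$, so it is unkilled when $\mathfrak p=1$. The first term of $\overline\Psi$ is the characteristic exponent of the (killed) Lévy process associated by the Lamperti transform with the strictly $\alpha$-stable process sent to $0$ on first exit from $(0,\infty)$. *)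

(* Defs.v *)
From HB Require Import structures.
From mathcomp Require Import all_boot all_order all_algebra.
From mathcomp Require Import all_classical all_reals all_analysis.
From mathcomp Require Import measurable_realfun complex.

Set Implicit Arguments.
Unset Strict Implicit.
Unset Printing Implicit Defensive.

Import Order.TTheory GRing.Theory Num.Theory.
Import numFieldNormedType.Exports.

Local Open Scope classical_set_scope.
Local Open Scope ring_scope.
Local Open Scope complex_scope.

Section complex_analysis.
Context {R : realType}.
Implicit Types (z : R[i]) (f : R -> R[i]) (x : R).

Definition cexp z : R[i] :=
  (expR (complex.Re z))%:C * (cos (complex.Im z) +i* sin (complex.Im z)).

(* Only meaningful for integrands with integrable real and imaginary parts,
   since Rintegral is 0 when the integral is infinite. *)
Definition cintegral d (T : measurableType d) (mu : {measure set T -> \bar R})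
    (D : set T) (g : T -> R[i]) : R[i] :=
  (\int[mu]_(t in D) complex.Re (g t)) +i* (\int[mu]_(t in D) complex.Im (g t)).

(* Functions of a real variable with complex values, differentiated
   componentwise. *)
Definition cderivable f x : Prop :=
  derivable (fun t => complex.Re (f t)) x 1 /\
  derivable (fun t => complex.Im (f t)) x 1.

Definition cderive1 f x : R[i] :=
  derive1 (fun t => complex.Re (f t)) x +i*
  derive1 (fun t => complex.Im (f t)) x.

(* Euler's integrals; they define the Gamma function on the half-plane
   of positive real parts (resp. on the positive half-line), which contains
   every argument at which it is used below. *)
Definition Gamma (a : R) : R :=
  \int[lebesgue_measure]_(t in `]0, +oo[) (t `^ (a - 1) * expR (- t)).

Definition cGamma z : R[i] :=
  cintegral lebesgue_measure `]0, +oo[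
    (fun t : R => cexp ((z - 1) * (ln t)%:C) * (expR (- t))%:C).

Definition cot x : R := cos x / sin x.

Lemma Gamma_ge0 (a : R) : 0 <= Gamma a.
Proof.
by apply: Rintegral_ge0 => t _; rewrite mulr_ge0 ?powR_ge0 ?expR_ge0.
Qed.

End complex_analysis.

Section levy_process.
Context {R : realType} d (Omega : measurableType d) (P : probability Omega R).

Definition char_fun (Y : {RV P >-> R}) (theta : R) : R[i] :=
  cintegral P setT (fun w => cexp (0 +i* (theta * Y w))).

(* The time set is [0, +oo[: the values X t for t < 0 are irrelevant. *)
Definition independent_increments (X : R -> {RV P >-> R}) : Prop :=
  forall (n : nat) (t : nat -> R) (A : nat -> set R),
    0 <= t 0%N -> {homo t : i j / (i <= j)%N >-> i <= j} ->
    (forall i, measurable (A i)) ->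
    P (\bigcap_(i in `I_n) [set w | A i (X (t i.+1) w - X (t i) w)]) =
    (\prod_(i < n) P [set w | A i (X (t i.+1) w - X (t i) w)%R])%E.

Definition stationary_increments (X : R -> {RV P >-> R}) : Prop :=
  forall (s t : R) (A : set R), 0 <= s -> s <= t -> measurable A ->
    P [set w | A (X t w - X s w)] = P [set w | A (X (t - s) w)].

Definition cadlag (f : R -> R) : Prop :=
  forall t, 0 <= t ->
    f s @[s --> t^'+] --> f t /\ (0 < t -> cvg (f s @[s --> t^'-])).

(* An unkilled real-valued Levy process started at 0. *)
Definition levy_process (X : R -> {RV P >-> R}) : Prop :=
  [/\ {ae P, forall w, X 0 w = 0}, independent_increments X,
      stationary_increments X & {ae P, forall w, cadlag (fun t => X t w)}].

End levy_process.

Section resurrection.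
Context {R : realType}.
Implicit Types (alpha rho x z : R).

Definition permissible alpha rho : Prop :=
  [\/ (0 < alpha < 1) /\ (0 < rho < 1),
      (1 < alpha < 2) /\ (1 - alpha^-1 < rho < alpha^-1) |
      alpha = 1 /\ rho = 2^-1].

Definition rho_hat rho : R := 1 - rho.

Definition c_minus alpha rho : R :=
  Gamma (alpha + 1) /
    (Gamma (alpha * rho_hat rho) * Gamma (1 - alpha * rho_hat rho)).

Variable phi : probability (measurableTypeR R) R.

Definition return_mass : R := 1 - fine (phi [set 0]).

Definition return_kernel z (A : set R) : \bar R :=
  phi [set `|z|^-1 * a | a in A].

(* Written as a measure on the whole line: when phi is carried by [0, +oo[
   it charges at most 0 outside ]0, +oo[, and it is only integrated over
   ]0, +oo[ below. *)
Definition resurrection_kernel alpha rho x (A : set (measurableTypeR R)) :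
    \bar R :=
  (\int[lebesgue_measure]_(z in `]-oo, 0%R[)
     ((c_minus alpha rho * (x - z) `^ (- 1 - alpha))%R%:E * return_kernel z A))%E.

Section resurrection_kernel_measure.
Variables alpha rho x : R.

Let dens z : \bar R := (c_minus alpha rho * (x - z) `^ (- 1 - alpha))%:E.

Let dens_ge0 z : (0 <= dens z)%E.
Proof.
by rewrite lee_fin mulr_ge0 ?powR_ge0// divr_ge0 ?mulr_ge0 ?Gamma_ge0.
Qed.

Let return_kernelE z (A : set R) : z < 0 ->
  return_kernel z A = phi ((fun w => `|z| * w) @^-1` A).
Proof.
move=> z0; have nz : `|z| != 0 by rewrite normr_eq0 lt_eqF.
congr (phi _); apply/seteqP; split => [_ [a Aa <-]|w /= Aw].
  by rewrite /= mulrA divff// mul1r.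
by exists (`|z| * w) => //; rewrite mulrA mulVf// mul1r.
Qed.

Let return_kernel_ge0 z (A : set R) : (0 <= return_kernel z A)%E.
Proof. exact: measure_ge0. Qed.

Let measurable_dens : measurable_fun setT dens.
Proof.
apply/measurable_EFinP; apply: measurable_funM; first exact: measurable_cst.
apply: (measurableT_comp (measurable_powR _)).
by apply: measurable_funB; [exact: measurable_cst|exact: measurable_id].
Qed.

Let measurable_return_kernel (A : set (measurableTypeR R)) : measurable A ->
  measurable_fun (`]-oo, 0[ : set R) (return_kernel ^~ A).
Proof.
move=> mA.
pose B := (fun zw : R * R => `|zw.1| * zw.2) @^-1` A.
have mB : measurable B.
  rewrite -[B]setTI; apply: (_ : measurable_fun setT _) => //.
  apply: measurable_funM; last exact: measurable_snd.
  by apply: measurableT_comp => //; exact: measurable_fst.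
have mphi : measurable_fun (`]-oo, 0[ : set R) (phi \o xsection B).
  apply: measurable_funTS; exact: measurable_fun_xsection.
apply: eq_measurable_fun mphi => z; rewrite inE/= in_itv/= => z0.
rewrite return_kernelE//=; congr (phi _).
by apply/seteqP; split => w; rewrite /xsection/= inE.
Qed.

Let kernel0 : resurrection_kernel alpha rho x set0 = 0%E.
Proof.
apply: integral0_eq => z _.
by rewrite /return_kernel image_set0 measure0 mule0.
Qed.

Let kernel_ge0 A : (0 <= resurrection_kernel alpha rho x A)%E.
Proof.
by apply: integral_ge0 => z _; rewrite mule_ge0// ?dens_ge0.
Qed.

Let kernel_sigma_additive :
  semi_sigma_additive (resurrection_kernel alpha rho x).
Proof.
move=> F mF tF mUF.
have -> : resurrection_kernel alpha rho x (\bigcup_n F n) =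
    (\sum_(0 <= n <oo) resurrection_kernel alpha rho x (F n))%E.
  rewrite /resurrection_kernel -integral_nneseries//; last 2 first.
  - move=> n; apply: emeasurable_funM; last exact: measurable_return_kernel.
    exact: measurable_funTS.
  - by move=> n z _; rewrite mule_ge0// ?dens_ge0.
  apply: eq_integral => z; rewrite inE/= in_itv/= => z0.
  rewrite nneseriesZl//.
  congr (_ * _)%E; rewrite return_kernelE// preimage_bigcup.
  have mpre n : measurable ((fun w : R => `|z| * w) @^-1` F n).
    rewrite -[X in measurable X]setTI.
    have mz : measurable_fun setT (fun w : R => `|z| * w).
      by apply: measurable_funM; [exact: measurable_cst|exact: measurable_id].
    by apply: mz => //; exact: mF.
  have tpre : trivIset setT (fun n => (fun w : R => `|z| * w) @^-1` F n).
    by move=> i j _ _ [w [Fi Fj]]; apply: tF => //; exists (`|z| * w).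
  apply: etrans (measure_bigcup phi _ _ (fun i _ => mpre i) tpre) _.
  under eq_eseriesl do rewrite in_setT.
  by apply: eq_eseriesr => n _; rewrite return_kernelE.
exact: is_cvg_nneseries.
Qed.

HB.instance Definition _ := isMeasure.Build _ _ _
  (resurrection_kernel alpha rho x) kernel0 kernel_ge0 kernel_sigma_additive.

End resurrection_kernel_measure.

Definition Psi_bar alpha rho (theta : R) : R[i] :=
  let a := alpha * rho_hat rho in
  cGamma (alpha -i* theta) / cGamma (a -i* theta) *
    (cGamma (1 +i* theta) / cGamma ((1 - a) +i* theta)) -
  cintegral (resurrection_kernel alpha rho 1) `]0, +oo[
    (fun y : R => cexp (0 +i* (theta * ln y))).

End resurrection.

(* Main.v *)
Require Import Defs.
From HB Require Import structures.
From mathcomp Require Import all_boot all_order all_algebra.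
From mathcomp Require Import all_classical all_reals all_analysis.
From mathcomp Require Import measurable_realfun complex.
From mathcomp Require Import ring lra.

(** Only the characteristic function of X = xi 1 matters.  It is
    exp (- Psi_bar), and Psi_bar = G - F, where G is the quotient of Gamma
    functions and F is the Fourier transform of the law of ln y under the
    finite measure q = q(1, dy).

    The function G is smooth at 0: the expansion of each factor (expands_cGamma)
    gives G (y) = r + i c y + O(y^2) with r and c real (expands_Gamma_ratio),
    and r is the mass of q, so that Psi_bar 0 = 0.  Hence the only part of
    Psi_bar that may fail to be differentiable at 0 is F.  Up to O(y^2),
    r - Re (F y) is at most a multiple of 1 - Re (E exp (i y X))
    (le_onem_expR_cos), and when ln is integrable for q the converse holds
    (onem_expR_cos_le).

    A real function Y has a finite first moment against a finite measure as
    soon as the sums over k of 2^k * int (1 - cos (e Y / 2^k)) are bounded,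
    and conversely: the sum of 2^k (1 - cos (x / 2^k)) is at most 6 |x|, and at
    least a multiple of |x| when |x| >= 1/2 (dyadic_onem_cos_le_norm,
    dyadic_onem_cos_ge).  An error O(y^2) changes these sums by a bounded
    amount, so X is integrable if and only if ln is integrable for q
    (jump_integrable_of_mean, mean_of_jump_integrable).  In that case all
    transforms are differentiable at 0, and comparing derivatives gives
    E X = int ln dq - c (mean_eq).

    The substitution u = - z turns q into the image of the product of the
    measure with density c_- (1 + u)^(- 1 - alpha) on the half-line and phi by
    multiplication (resurrection_integral_halfline).  Since ln (u w) = ln u +
    ln w and ln u has a finite mean for the first factor, ln is integrable for
    q exactly when it is for phi (resurrection_log_ltyP), and
    int ln dq = c_- int (1 + u)^(- 1 - alpha) ln u du + r int ln dphi
    (resurrection_ln_mean).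

    What remains is about Gamma.  The Beta integral (eGamma_beta) yields the
    functional equation, the finiteness of Gamma, and, differentiated in its
    parameter, the integral of (1 + u)^(- 1 - alpha) ln u (integral_kernel_ln).
    With D the logarithmic derivative of Gamma, this integral contributes
    r (D 1 - D alpha) to E X, while c = r (D 1 - D alpha - pi cot (pi a)) with
    a = alpha (1 - rho); the terms D 1 - D alpha cancel and pi cot (pi a)
    survives.  The cotangent comes from D (1 - a) - D a = pi cot (pi a)
    (dGamma_reflection), the logarithmic derivative of the reflection formula
    Gamma a Gamma (1 - a) sin (pi a) = pi; the reflection formula also turns
    r = Gamma alpha / (Gamma a Gamma (1 - a)) into the stated prefactor.  It is
    proved by comparing Gamma (m + 1 + a) Gamma (m + 1 - a) with the integrals
    of cos (2 a t) cos (t)^(2m) over [0, pi/2], which obey the inverse recursion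
    in m (Gamma_reflection_wallis), and letting m tend to infinity. *)

Set Implicit Arguments.
Unset Strict Implicit.
Unset Printing Implicit Defensive.

Import Order.TTheory GRing.Theory Num.Theory.
Import numFieldNormedType.Exports.

Local Open Scope classical_set_scope.
Local Open Scope ring_scope.
Local Open Scope complex_scope.

(** * Integrals over the half-line *)

Section integration.
Context {R : realType}.
Local Open Scope ereal_scope.
Local Notation mu := (@lebesgue_measure R).

Lemma tonelli_on d1 d2 (T1 : measurableType d1) (T2 : measurableType d2)
    (m1 : {sigma_finite_measure set T1 -> \bar R})
    (m2 : {sigma_finite_measure set T2 -> \bar R})
    (A : set T1) (B : set T2) (f : T1 * T2 -> \bar R) :
  measurable A -> measurable B -> measurable_fun setT f ->
  (forall z, 0 <= f z) ->
  \int[m1]_(x in A) \int[m2]_(y in B) f (x, y) =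
  \int[m2]_(y in B) \int[m1]_(x in A) f (x, y).
Proof.
move=> mA mB mf f0.
pose g := f \_ (A `*` B).
have mg : measurable_fun setT g.
  by apply/(measurable_restrictT _ (measurableX mA mB)); exact: measurable_funTS.
have g0 z : 0 <= g z by rewrite /g patchE; case: ifP.
have gA x y : x \in A -> g (x, y) = ((fun y => f (x, y)) \_ B) y.
  move=> /set_mem Ax; rewrite /g !patchE; congr (if _ then _ else _).
  by apply/idP/idP => /set_mem H; apply/mem_set => //; case: H.
have gB x y : y \in B -> g (x, y) = ((fun x => f (x, y)) \_ A) x.
  move=> /set_mem By; rewrite /g !patchE; congr (if _ then _ else _).
  by apply/idP/idP => /set_mem H; apply/mem_set => //; case: H.
transitivity (\int[m1]_x \int[m2]_y g (x, y)).
  rewrite integral_mkcond; apply: eq_integral => x _; rewrite patchE.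
  case: ifPn => Ax.
    by rewrite integral_mkcond; apply: eq_integral => y _; rewrite gA.
  rewrite integral0_eq// => y _; rewrite /g patchE ifF//.
  by apply/negP => /set_mem[/= /mem_set]; rewrite (negbTE Ax).
rewrite (@fubini_tonelli _ _ _ _ _ m1 m2 g mg g0).
rewrite [RHS]integral_mkcond; apply: eq_integral => y _; rewrite patchE.
case: ifPn => By.
  by rewrite [RHS]integral_mkcond; apply: eq_integral => x _; rewrite gB.
rewrite integral0_eq// => x _; rewrite /g patchE ifF//.
by apply/negP => /set_mem[_ /= /mem_set]; rewrite (negbTE By).
Qed.

(** The measure A |-> c * |A / c| agrees with Lebesgue measure on intervals. *)
Lemma lebesgue_integral_scale (c : R) (f : R -> \bar R) : (0 < c)%R ->
  measurable_fun [set: R] f -> (forall x, 0 <= f x) ->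
  \int[mu]_(x in `]0%R, +oo[) f x =
  c%:E * \int[mu]_(x in `]0%R, +oo[) f (c * x)%R.
Proof.
move=> c0 mf f0.
have mc : measurable_fun [set: measurableTypeR R]
    (fun x : measurableTypeR R => (c * x)%R : measurableTypeR R).
  exact: mulrl_measurable.
pose k : {nonneg R} := NngNum (ltW c0).
have preim (i : interval R) : (fun x : R => (c * x)%R) @^-1` [set` i] =
    [set` match i with Interval a b => Interval
      (match a with BSide s x => BSide s (c^-1 * x)%R | BInfty s => BInfty _ s end)
      (match b with BSide s x => BSide s (c^-1 * x)%R | BInfty s => BInfty _ s end) end].
  apply/seteqP; split => x /=; case: i => [[[|] a|[|]] [[|] b|[|]]];
  by rewrite !in_itv/= ?ler_pdivrMl ?ltr_pdivrMl ?ler_pdivlMl ?ltr_pdivlMl.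
pose h := fun x : measurableTypeR R => (c * x)%R : measurableTypeR R.
pose nu' : {measure set (measurableTypeR R) -> \bar R} :=
  mscale k (pushforward mu h).
pose nu := nu' mc.
have muE A : measurable A -> nu A = mu A.
  move=> mA; apply/esym; apply: (@lebesgue_measure_unique _ nu) => //=.
  move=> _ [[a b]] _ <-.
  rewrite /nu /nu'/= /mscale/= /pushforward (preim `]a, b]%O) !lebesgue_measure_itv/=.
  rewrite !lte_fin ltr_pM2l ?invr_gt0//; case: ifP => _; last by rewrite mule0.
  by rewrite -!EFinB -EFinM; congr EFin; field; rewrite gt_eqF.
transitivity (\int[nu]_(x in `]0%R, +oo[) f x).
  by apply: eq_measure_integral => A mA _; exact/esym/muE.
rewrite ge0_integral_mscale//; last exact: measurable_funTS.
congr (_ * _).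
rewrite ge0_integral_pushforward//; last exact: measurable_funTS.
by rewrite (preim `]0%R, +oo[%O) /= mulr0.
Qed.

End integration.

(** * Euler's Gamma and Beta integrals *)

Section gamma.
Context {R : realType}.
Implicit Types (p q x : R).
Local Notation mu := (@lebesgue_measure R).
Local Notation halfline := (`]0%R, +oo[%classic : set R).

(** Euler's integral with values in [0, +oo]: identities between such integrals
    hold before their finiteness is known, and finiteness is then deduced from
    them. *)
Definition eGamma x : \bar R :=
  (\int[mu]_(t in halfline) (t `^ (x - 1) * expR (- t))%:E)%E.

Lemma GammaE x : Gamma x = fine (eGamma x). Proof. by []. Qed.

Lemma halflineP t : t \in halfline -> 0 < t.
Proof. by rewrite inE/= in_itv/= andbT. Qed.

Lemma eGamma_ge0 x : (0 <= eGamma x)%E.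
Proof.
by apply: integral_ge0 => t _; rewrite lee_fin mulr_ge0 ?powR_ge0 ?expR_ge0.
Qed.

Lemma measurable_expRN (c : R) : measurable_fun [set: R] (fun t : R => expR (- (c * t))).
Proof.
apply: (measurableT_comp (@measurable_expR R)).
by apply: measurableT_comp => //; exact: mulrl_measurable.
Qed.

Lemma ge0_integralZlR d (T : measurableType d)
    (m : {measure set T -> \bar R}) (D : set T) (k : R) (f : T -> R) :
  measurable D -> 0 <= k -> (forall t, 0 <= f t) -> measurable_fun setT f ->
  (\int[m]_(t in D) (k * f t)%:E = k%:E * \int[m]_(t in D) (f t)%:E)%E.
Proof.
move=> mD k0 f0 mf; under eq_integral do rewrite EFinM.
rewrite ge0_integralZl//.
- by apply: measurable_funTS; exact/measurable_EFinP.
- by move=> t _; rewrite lee_fin.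
Qed.

Lemma gt0_powRD (r s x : R) : 0 < x -> x `^ (r + s) = x `^ r * x `^ s.
Proof. by move=> x0; rewrite powRD// (gt_eqF x0) implybT. Qed.

Lemma eGamma_scale (c x : R) : 0 < c ->
  eGamma x = ((c `^ x)%:E *
    \int[mu]_(t in halfline) (t `^ (x - 1) * expR (- (c * t)))%:E)%E.
Proof.
move=> c0; rewrite /eGamma (lebesgue_integral_scale c0); first last.
- by move=> t; rewrite lee_fin mulr_ge0 ?powR_ge0 ?expR_ge0.
- apply/measurable_EFinP; apply: measurable_funM; first exact: measurable_powR.
  by apply: measurableT_comp => //; exact: measurableT_comp.
have mf : measurable_fun [set: R] (fun t => t `^ (x - 1) * expR (- (c * t))).
  by apply: measurable_funM; [exact: measurable_powR|exact: measurable_expRN].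
have mg : measurable_fun [set: R]
    (fun t => (c * t) `^ (x - 1) * expR (- (c * t))).
  apply: measurable_funM; last exact: measurable_expRN.
  by apply: (measurableT_comp (measurable_powR _)); exact: mulrl_measurable.
have f0 t : 0 <= t `^ (x - 1) * expR (- (c * t)).
  by rewrite mulr_ge0 ?powR_ge0 ?expR_ge0.
have g0 t : 0 <= (c * t) `^ (x - 1) * expR (- (c * t)).
  by rewrite mulr_ge0 ?powR_ge0 ?expR_ge0.
have mD : measurable halfline by [].
rewrite -[LHS](ge0_integralZlR mu mD (ltW c0) g0 mg).
rewrite -[RHS](ge0_integralZlR mu mD (powR_ge0 _ _) f0 mf).
apply: eq_integral => t /halflineP t0.
rewrite powRM ?ltW// !mulrA; congr (_ * _ * _)%:E.
by rewrite -{1}(powRr1 (ltW c0)) -powRD ?(gt_eqF c0) ?implybT// addrC subrK.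
Qed.

(** In the double integral Gamma p * Gamma q the variable of the first factor is
    rescaled by that of the second; after exchanging the two integrals the inner
    one is a rescaled Gamma (p + q).  No condition on p and q, since all
    integrands are nonnegative. *)
Lemma eGamma_beta p q : (eGamma p * eGamma q = eGamma (p + q) *
  \int[mu]_(u in halfline) (u `^ (p - 1) * (1 + u) `^ (- (p + q)))%:E)%E.
Proof.
pose F (z : R * R) := z.1 `^ (p + q - 1) * (z.2 `^ (p - 1) * expR (- ((1 + z.2) * z.1))).
have mD : measurable halfline by [].
have F0 z : 0 <= F z by rewrite !mulr_ge0 ?powR_ge0 ?expR_ge0.
have mF : measurable_fun [set: R * R] F.
  apply: measurable_funM.
    exact: (measurableT_comp (measurable_powR _) measurable_fst).
  apply: measurable_funM.
    exact: (measurableT_comp (measurable_powR _) measurable_snd).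
  apply: (measurableT_comp (@measurable_expR R)).
  apply: measurableT_comp => //; apply: measurable_funM; last exact: measurable_fst.
  by apply: measurable_funD; [exact: measurable_cst|exact: measurable_snd].
have mg x : measurable_fun [set: R] (fun t : R => t `^ x * expR (- t)).
  apply: measurable_funM; first exact: measurable_powR.
  exact: measurableT_comp.
have g0 x (t : R) : 0 <= t `^ x * expR (- t).
  by rewrite mulr_ge0 ?powR_ge0 ?expR_ge0.
have mh t x : measurable_fun [set: R] (fun u : R => u `^ x * expR (- (t * u))).
  by apply: measurable_funM; [exact: measurable_powR|exact: measurable_expRN].
have h0 t x (u : R) : 0 <= u `^ x * expR (- (t * u)).
  by rewrite mulr_ge0 ?powR_ge0 ?expR_ge0.
have mk : measurable_fun [set: R] (fun u : R => u `^ (p - 1) * (1 + u) `^ (- (p + q))).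
  apply: measurable_funM; first exact: measurable_powR.
  apply: (measurableT_comp (measurable_powR _)).
  by apply: measurable_funD; [exact: measurable_cst|exact: measurable_id].
transitivity (\int[mu]_(t in halfline) \int[mu]_(u in halfline) (F (t, u))%:E)%E.
  rewrite {2}/eGamma -ge0_integralZl//; first last.
  - exact: eGamma_ge0.
  - by move=> t _; rewrite lee_fin.
  - by apply: measurable_funTS; apply/measurable_EFinP; exact: mg.
  apply: eq_integral => t /halflineP t0.
  rewrite (eGamma_scale p t0) muleAC -EFinM.
  rewrite -(ge0_integralZlR mu mD _ (h0 t (p - 1)) (mh t (p - 1))); last first.
    by rewrite !mulr_ge0 ?powR_ge0 ?expR_ge0.
  apply: eq_integral => u /halflineP u0; congr EFin; rewrite /F/=.
  rewrite -addrA (gt0_powRD p (q - 1) t0).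
  by rewrite mulrDl mul1r opprD expRD (mulrC u t); ring.
rewrite (@tonelli_on _ _ _ _ _ mu mu _ _ (EFin \o F)) //; last first.
  exact/measurable_EFinP.
rewrite -ge0_integralZl//; first last.
- exact: eGamma_ge0.
- by move=> u _; rewrite lee_fin mulr_ge0 ?powR_ge0.
- by apply: measurable_funTS; exact/measurable_EFinP.
apply: eq_integral => u /halflineP u0.
have u1 : 0 < 1 + u by rewrite addr_gt0.
rewrite (eGamma_scale (p + q) u1) muleAC -EFinM.
rewrite mulrCA powRN divff ?gt_eqF ?powR_gt0// mulr1.
rewrite -(ge0_integralZlR mu mD (powR_ge0 u (p - 1))
  (h0 (1 + u) (p + q - 1)) (mh (1 + u) (p + q - 1))).
by apply: eq_integral => t /halflineP t0; congr EFin; rewrite /F/= mulrCA.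
Qed.

Lemma is_derive_cvg (f : R -> R) (x df : R) :
  is_derive x 1 f df -> {for x, continuous f}.
Proof.
move=> fdf; apply: differentiable_continuous; apply/derivable1_diffP.
exact: ex_derive.
Qed.

Lemma eGamma1 : eGamma 1 = 1%E.
Proof.
rewrite /eGamma integral_itv_obnd_cbnd; last first.
  apply/measurable_EFinP; apply: measurable_funTS.
  by apply: measurable_funM; [exact: measurable_powR|exact: measurableT_comp].
have df (x : R) : is_derive x 1 (fun t : R => - expR (- t)) (expR (- x)).
  have H := is_derive1_comp (is_derive_expR (- x)) (is_deriveNid x 1).
  by apply: (is_derive_eq (is_deriveN H)); rewrite mulrN1 opprK.
under eq_integral do rewrite subrr powRr0 mul1r.
rewrite (@ge0_continuous_FTC2y _ _ (fun t => - expR (- t)) 0 0).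
- by rewrite oppr0 expR0 -EFinD opprK add0r.
- by move=> t _; rewrite expR_ge0.
- apply: continuous_subspaceT => x.
  exact: (is_derive_cvg (is_derive1_comp (is_derive_expR (- x)) (is_deriveNid x 1))).
- by rewrite -oppr0; apply: cvgN; exact: cvgr_expR.
- by move=> x _; exact: ex_derive.
- apply: cvg_at_right_filter; exact: (is_derive_cvg (df 0)).
- by move=> x _; rewrite derive1E; exact: derive_val.
Unshelve. all: by end_near. Qed.

Lemma integral_onem_powR (a : R) : 0 < a ->
  (\int[mu]_(u in halfline) (u `^ (1 - 1) * (1 + u) `^ (- (1 + a)))%:E = (a^-1)%:E)%E.
Proof.
move=> a0; rewrite integral_itv_obnd_cbnd; last first.
  apply/measurable_EFinP; apply: measurable_funTS.
  apply: measurable_funM; first exact: measurable_powR.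
  apply: (measurableT_comp (measurable_powR _)).
  by apply: measurable_funD; [exact: measurable_cst|exact: measurable_id].
have df b (x : R) : 0 <= x -> is_derive x 1 (fun u : R => (1 + u) `^ b) (b * (1 + x) `^ (b - 1)).
  move=> x0; have x1 : 0 < 1 + x by lra.
  have d1 : is_derive x (1 : R) (fun u : R => 1 + u) (0 + 1).
    by apply: is_deriveD.
  have H := is_derive1_comp (is_derive1_powR b x1) d1.
  by apply: (is_derive_eq H); rewrite add0r mulr1.
have dF (x : R) : 0 <= x -> is_derive x 1 (fun u : R => - a^-1 * (1 + u) `^ (- a)) ((1 + x) `^ (- (1 + a))).
  move=> x0; apply: (is_derive_eq (is_deriveZ (- a^-1) (df (- a) x x0))).
  rewrite /GRing.scale/= mulrA mulrNN mulVf ?gt_eqF// mul1r; congr (_ `^ _).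
  by rewrite opprD addrC.
under eq_integral do rewrite subrr powRr0 mul1r.
rewrite (@ge0_continuous_FTC2y _ _ (fun u => - a^-1 * (1 + u) `^ (- a)) 0 0).
- by rewrite addr0 powR1 mulr1 -EFinB sub0r opprK.
- by move=> t _; exact: powR_ge0.
- apply: continuous_in_subspaceT => x; rewrite inE/= in_itv/= andbT => x0.
  exact: (is_derive_cvg (df _ _ x0)).
- rewrite -[X in _ --> X](mulr0 (- a^-1)); apply: cvgM; first exact: cvg_cst.
  apply/cvgrPdist_lt => e e0; near=> u.
  have u1 : 0 < 1 + u by rewrite addr_gt0//; near: u; exact: nbhs_pinfty_gt.
  rewrite sub0r normrN ger0_norm ?powR_ge0// /powR gt_eqF//.
  rewrite -[ltRHS]lnK// ltr_expR mulNr ltrNl mulrC -ltr_pdivrMr//.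
  rewrite -ltr_expR (lnK u1) -ltrBlDl; near: u; exact: nbhs_pinfty_gt.
- by move=> x x0; have [] := dF _ (ltW x0).
- apply: cvg_at_right_filter; exact: (is_derive_cvg (dF 0 (lexx _))).
- move=> x; rewrite in_itv/= andbT => x0; rewrite derive1E.
  by have [] := dF _ (ltW x0).
Unshelve. all: by end_near. Qed.

(** The Beta identity with first argument 1, whose kernel integrates
    explicitly. *)
Lemma eGammaD1 p : 0 < p -> eGamma (p + 1) = (p%:E * eGamma p)%E.
Proof.
move=> p0; have := eGamma_beta 1 p.
rewrite eGamma1 mul1e integral_onem_powR// => ->.
by rewrite muleCA -EFinM mulfV ?gt_eqF// mule1 addrC.
Qed.

Lemma eGamma_nat_lty (n : nat) : (eGamma n.+1%:R < +oo)%E.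
Proof.
elim: n => [|n IH]; first by rewrite eGamma1 ltry.
by rewrite -natr1 eGammaD1// lte_mul_pinfty// lee_fin.
Qed.

(** Finiteness at the positive integers follows from the functional equation;
    it propagates to [1, +oo[ because t^(q - 1) is at most 1 + t^n for
    1 <= q <= n + 1, and to ]0, 1[ by the functional equation read backwards. *)
Lemma eGamma_lty p : 0 < p -> (eGamma p < +oo)%E.
Proof.
move=> p0.
suff h q : 1 <= q -> (eGamma q < +oo)%E.
  have p1 : 1 <= p + 1 by lra.
  have := h _ p1; rewrite eGammaD1//.
  case: (eGamma p) (eGamma_ge0 p) => [r||]//.
  - by move=> *; rewrite ltry.
  - by rewrite mulry gtr0_sg// mul1e.
move=> q1; have [n qn] : exists n : nat, q <= n.+1%:R.
  by exists (Num.truncn q); rewrite ltW// truncnS_gt.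
have mF x : measurable_fun halfline (fun t : R => (t `^ (x - 1) * expR (- t))%:E).
  apply: measurable_funTS; apply/measurable_EFinP.
  apply: measurable_funM; first exact: measurable_powR.
  exact: measurableT_comp.
have F0 x (t : R) : (0 <= (t `^ (x - 1) * expR (- t))%:E)%E.
  by rewrite lee_fin mulr_ge0 ?powR_ge0 ?expR_ge0.
apply: (@le_lt_trans _ _ (eGamma 1 + eGamma n.+1%:R)%E); last first.
  by apply: lte_add_pinfty; [rewrite eGamma1 ltry|exact: eGamma_nat_lty].
rewrite -[X in (_ <= X)%E](ge0_integralD mu _ _ (mF 1) _ (mF n.+1%:R))//.
apply: ge0_le_integral => //.
- exact: mF.
- by apply: emeasurable_funD; exact: mF.
move=> t; rewrite /= in_itv/= andbT => t0.
rewrite -EFinD lee_fin -mulrDl ler_wpM2r ?expR_ge0// subrr powRr0.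
have [t1|t1] := lerP t 1.
  apply: (@le_trans _ _ 1); last by rewrite lerDl powR_ge0.
  by rewrite -[leRHS](powRr0 t) ger_powR ?t0//; lra.
apply: (@le_trans _ _ (t `^ (n.+1%:R - 1))); last by rewrite lerDr.
by rewrite ler_powR ?(ltW t1)//; lra.
Qed.

Lemma eGammaE p : 0 < p -> eGamma p = (Gamma p)%:E.
Proof.
by move=> p0; rewrite GammaE fineK// ge0_fin_numE ?eGamma_ge0// eGamma_lty.
Qed.

(** On [1, 2] the integrand is bounded below by a positive constant. *)
Lemma Gamma_gt0 p : 0 < p -> 0 < Gamma p.
Proof.
move=> p0; rewrite -lte_fin -eGammaE//.
have mF : measurable_fun [set: R] (fun t : R => (t `^ (p - 1) * expR (- t))%:E).
  apply/measurable_EFinP.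
  apply: measurable_funM; first exact: measurable_powR.
  exact: measurableT_comp.
(* The minimum over [1, 2] of t^(-1) times that of e^(- t). *)
pose c : R := 2^-1 * expR (- 2).
apply: (@lt_le_trans _ _ (\int[mu]_(t in `[1%R, 2%R]) (cst c%:E t))%E).
  rewrite integral_cst//= lebesgue_measure_itv/= lte_fin ltr1n -EFinD -EFinM lte_fin.
  by rewrite !mulr_gt0 ?expR_gt0 ?invr_gt0//; lra.
apply: (@le_trans _ _ (\int[mu]_(t in `[1%R, 2%R]) (t `^ (p - 1) * expR (- t))%:E)%E).
  apply: ge0_le_integral => //.
  - by move=> t _; rewrite lee_fin mulr_ge0 ?expR_ge0 ?invr_ge0.
  - exact: measurable_funTS.
  move=> t; rewrite /= in_itv/= => /andP[t1 t2].
  rewrite lee_fin ler_pM ?expR_ge0 ?invr_ge0 ?ler_expR ?lerN2//.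
  rewrite -[leLHS]powR_inv1//.
  apply: (@le_trans _ _ (t `^ (-1))); last by rewrite ler_powR//; lra.
  by rewrite !powR_inv1 ?lef_pV2 ?posrE; lra.
apply: ge0_subset_integral => //.
- exact: measurable_funTS.
- by move=> t _; rewrite lee_fin mulr_ge0 ?powR_ge0 ?expR_ge0.
- by move=> t; rewrite /= !in_itv/= => /andP[t1 t2]; rewrite andbT; lra.
Qed.

Lemma Gamma1 : Gamma 1 = 1 :> R.
Proof. by rewrite GammaE eGamma1. Qed.

Lemma GammaD1 p : 0 < p -> Gamma (p + 1) = p * Gamma p.
Proof.
move=> p0; have p1 : 0 < p + 1 by rewrite addr_gt0.
by have := eGammaD1 p0; rewrite !eGammaE// -EFinM => -[].
Qed.

Lemma eGamma_beta_kernel (a s : R) : -1 < s -> s < a ->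
  (\int[mu]_(u in halfline) (u `^ s * (1 + u) `^ (- (1 + a)))%:E =
   (Gamma (1 + s) * Gamma (a - s) / Gamma (1 + a))%:E)%E.
Proof.
move=> s1 sa; have G0 : 0 < Gamma (1 + a) by apply: Gamma_gt0; lra.
have [h1 h2 h3] : [/\ 0 < 1 + s, 0 < a - s & 0 < 1 + s + (a - s)].
  by split; lra.
have := eGamma_beta (1 + s) (a - s); rewrite !eGammaE//.
rewrite [1 + s + _](_ : _ = 1 + a); last by ring.
rewrite [1 + s - 1](_ : _ = s); last by ring.
set I := integral _ _ _ => /(congr1 (fun y : \bar R => (Gamma (1 + a))^-1%:E * y)%E).
rewrite [in RHS]muleA -!EFinM mulVf ?(gt_eqF G0)// mul1e => <-.
by rewrite mulrC.
Qed.

(** * Differentiating Mellin integrals *)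

Definition mellin_integrable (w : R -> R) (s : R) : Prop :=
  mu.-integrable halfline (EFin \o (fun u => u `^ s * w u)).

Lemma measurable_mellin (w : R -> R) (s : R) : measurable_fun [set: R] w ->
  measurable_fun halfline (EFin \o (fun u => u `^ s * w u)).
Proof.
move=> mw; apply: measurable_funTS; apply/measurable_EFinP.
by apply: measurable_funM => //; exact: measurable_powR.
Qed.

(** The factor e^(k |ln u|) is at most u^k + u^(-k), so it may be absorbed in
    the exponent of the Mellin integral; powers of |ln u| are dominated by it. *)
Lemma le_mellin_integrable (w g : R -> R) (s k c : R) :
  mellin_integrable w (s - k) -> mellin_integrable w (s + k) ->
  measurable_fun [set: R] g -> (forall u, 0 <= w u) -> 0 <= c ->
  (forall u, 0 < u -> `|g u| <= c * (u `^ s * expR (k * `|ln u|) * w u)) ->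
  mu.-integrable halfline (EFin \o g).
Proof.
move=> im ip mg w0 c0 gle.
apply: (@le_integrable _ _ _ mu halfline _ _
  (EFin \o (fun u => c * (u `^ (s - k) * w u + u `^ (s + k) * w u)))) => //.
- by apply: measurable_funTS; exact/measurable_EFinP.
- move=> u /mem_set/halflineP u0; rewrite /= lee_fin.
  rewrite [leRHS]ger0_norm; last first.
    by rewrite mulr_ge0// addr_ge0// mulr_ge0// powR_ge0.
  apply: (le_trans (gle u u0)); rewrite ler_wpM2l//.
  rewrite -mulrDl ler_wpM2r// !gt0_powRD// -mulrDr ler_wpM2l ?powR_ge0//.
  rewrite /powR gt_eqF// mulNr.
  by case: (ger0P (ln u)) => _; rewrite ?mulrN ?lerDl ?lerDr expR_ge0.
- have H := integrableZl _ c (integrableD _ im ip).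
  by apply: eq_integrable (H _ _) => // u _; rewrite /= EFinM EFinD.
Qed.

(** Differentiation under the integral sign, with the derivative of the integrand
    given explicitly. *)
Lemma is_derive_under_integral d (T : measurableType d)
    (m : {measure set T -> \bar R}) (D : set T) (f df : R -> T -> R)
    (G : T -> R) (a e : R) : measurable D -> 0 < e ->
  (forall x, a - e < x < a + e -> m.-integrable D (EFin \o f x)) ->
  (forall x y, a - e < x < a + e -> D y -> is_derive x 1 (f ^~ y) (df x y)) ->
  (forall y, 0 <= G y) -> m.-integrable D (EFin \o G) ->
  (forall x y, a - e < x < a + e -> D y -> `|df x y| <= G y) ->
  is_derive a 1 (fun x => \int[m]_(y in D) f x y) (\int[m]_(y in D) df a y).
Proof.
move=> mD e0 intf dfx G0 intG GE.
have aa : a - e < a < a + e by apply/andP; split; lra.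
have Ia : [set` `]a - e, a + e[%R] a by rewrite /= in_itv.
have intf' x : [set` `]a - e, a + e[%R] x -> m.-integrable D (EFin \o f x).
  by rewrite /= in_itv/=; exact: intf.
have dF x y : [set` `]a - e, a + e[%R] x -> D y -> derivable (f ^~ y) x 1.
  by rewrite /= in_itv/= => Ix Dy; have [] := dfx x y Ix Dy.
have GE' x y : [set` `]a - e, a + e[%R] x -> D y -> `|partial1of2 f x y| <= G y.
  rewrite /= in_itv/= => Ix Dy; rewrite partial1of2E.
  by have [_ ->] := dfx x y Ix Dy; exact: GE.
apply: DeriveDef.
  exact: (@derivable_under_integral _ _ _ m f D mD a _ _ Ia intf' dF G G0 intG GE').
rewrite -derive1E (differentiation_under_integral mD Ia intf' dF G0 intG GE').
apply: eq_Rintegral => y /set_mem Dy; rewrite partial1of2E.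
by have [_ ->] := dfx a y aa Dy.
Qed.

Lemma mellin_derive (w : R -> R) (s k : R) : 0 < k ->
  measurable_fun [set: R] w -> (forall u, 0 <= w u) ->
  mellin_integrable w (s - 2 * k) -> mellin_integrable w (s + 2 * k) ->
  is_derive s 1 (fun x => \int[mu]_(u in halfline) (u `^ x * w u))
    (\int[mu]_(u in halfline) (ln u * (u `^ s * w u))).
Proof.
move=> k0 mw w0 im ip.
pose f x u : R := u `^ x * w u.
have dfx (x u : R) : 0 < u -> is_derive x 1 (f ^~ u) (ln u * (u `^ x * w u)).
  move=> u0; rewrite /f /powR gt_eqF//.
  have dl : is_derive x (1 : R) (fun y : R => y * ln u) (ln u).
    have -> : (fun y : R => y * ln u) = (ln u \*: id).
      by apply/funext => y; rewrite /= mulrC.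
    apply: is_derive_eq; exact: mulr1.
  have de := @is_derive1_comp _ expR (fun y : R => y * ln u) _ _ _
    (is_derive_expR (x * ln u)) dl.
  have -> : (fun y => expR (y * ln u) * w u) = (w u \*: (expR \o (fun y : R => y * ln u))).
    by apply/funext => y; rewrite /= mulrC.
  apply: (is_derive_eq (is_deriveZ (w u) de)).
  by rewrite /GRing.scale/=; ring.
have bnd (x u : R) : 0 < u -> s - k < x < s + k -> u `^ x <= u `^ s * expR (k * `|ln u|).
  move=> u0 /andP[sx xs]; rewrite /powR gt_eqF// -expRD ler_expR.
  rewrite -lerBlDl -mulrBl (le_trans (ler_norm _))// normrM ler_wpM2r//.
  by rewrite ler_norml; apply/andP; split; lra.
have intf x : s - k < x < s + k -> mu.-integrable halfline (EFin \o f x).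
  move=> sx; apply: (@le_mellin_integrable w _ s (2 * k) 1) => //.
    by apply: measurable_funM => //; exact: measurable_powR.
  move=> u u0; rewrite mul1r ger0_norm ?mulr_ge0 ?powR_ge0// ler_wpM2r//.
  apply: (le_trans (bnd _ _ u0 sx)); rewrite ler_wpM2l ?powR_ge0//.
  by rewrite ler_expR ler_wpM2r//; lra.
(* Dominates the derivative on ]s - k, s + k[: one factor e^(k |ln u|) bounds
   k |ln u|, the other the variation of the exponent. *)
pose G u : R := k^-1 * (u `^ s * expR (2 * k * `|ln u|) * w u).
have intG : mu.-integrable halfline (EFin \o G).
  apply: (@le_mellin_integrable w _ s (2 * k) k^-1) => //.
  - apply: measurable_funM => //; apply: measurable_funM => //.
    apply: measurable_funM => //.
    apply: measurableT_comp => //; apply: measurable_funM => //.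
    apply: measurableT_comp => //; exact: measurable_ln.
  - by rewrite invr_ge0 ltW.
  move=> u u0; rewrite ger0_norm// mulr_ge0 ?invr_ge0 ?(ltW k0)//.
  by rewrite !mulr_ge0 ?powR_ge0 ?expR_ge0.
apply: (@is_derive_under_integral _ _ mu halfline f
  (fun x u => ln u * (u `^ x * w u)) G s k) => //.
- by move=> x u sx /mem_set/halflineP u0; exact: dfx.
- by move=> u; rewrite !mulr_ge0 ?invr_ge0 ?(ltW k0) ?powR_ge0 ?expR_ge0.
move=> x u sx /mem_set/halflineP u0.
rewrite normrM (ger0_norm (_ : 0 <= u `^ x * w u)) ?mulr_ge0 ?powR_ge0//.
rewrite /G [leRHS]mulrA [leLHS]mulrA ler_wpM2r//.
rewrite ler_pdivlMl// mulrA.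
have -> : 2 * k * `|ln u| = k * `|ln u| + k * `|ln u| by ring.
rewrite expRD mulrCA; apply: ler_pM => //.
- by rewrite mulr_ge0// ltW.
- by rewrite powR_ge0.
- by apply: le_trans (expR_ge1Dx _); rewrite lerDr.
- exact: bnd.
Qed.

Lemma near0_lt (k : R) : 0 < k -> \forall s \near (0 : R), `|s| < k.
Proof. by move=> k0; exists k => //= s /=; rewrite sub0r normrN. Qed.

(** The derivative of Gamma, as an integral. *)
Definition dGamma x : R :=
  \int[mu]_(t in halfline) (ln t * (t `^ (x - 1) * expR (- t))).

Lemma Gamma_mellin_integrable x : 0 < x ->
  mellin_integrable (fun t => expR (- t)) (x - 1).
Proof.
move=> x0; apply/integrableP; split.
  by apply: measurable_mellin; exact: measurableT_comp.
apply: le_lt_trans (eGamma_lty x0); rewrite le_eqVlt; apply/orP; left.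
apply/eqP; apply: eq_integral => t _ /=.
by rewrite ger0_norm// mulr_ge0 ?powR_ge0 ?expR_ge0.
Qed.

Lemma is_derive_Gamma x : 0 < x -> is_derive x 1 (@Gamma R) (dGamma x).
Proof.
move=> x0.
have d1 : is_derive (x - 1) 1
    (fun y => \int[mu]_(u in halfline) (u `^ y * expR (- u))) (dGamma x).
  apply: (@mellin_derive (fun u => expR (- u)) (x - 1) (x / 4)).
  - by rewrite divr_gt0.
  - exact: measurableT_comp.
  - by move=> u; exact: expR_ge0.
  - rewrite (_ : x - 1 - _ = x / 2 - 1); last by field.
    by apply: Gamma_mellin_integrable; rewrite divr_gt0.
  - rewrite (_ : x - 1 + _ = x * (3 / 2) - 1); last by field.
    by apply: Gamma_mellin_integrable; rewrite !mulr_gt0.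
have d2 : is_derive x (1 : R) (fun y : R => y - 1) (1 + 0).
  exact: is_deriveD.
have := @is_derive1_comp _ (fun y => \int[mu]_(u in halfline) (u `^ y * expR (- u)))
  (fun y => y - 1) x _ _ d1 d2.
by rewrite addr0 mulr1.
Qed.

Lemma kernel_mellin_integrable (a s : R) : -1 < s -> s < a ->
  mellin_integrable (fun u => `|1 + u| `^ (- (1 + a))) s.
Proof.
move=> s1 sa; apply/integrableP; split.
  apply: measurable_mellin; apply: (measurableT_comp (measurable_powR _)).
  apply: measurableT_comp => //.
  by apply: measurable_funD; [exact: measurable_cst|exact: measurable_id].
apply: (@le_lt_trans _ _
    (\int[mu]_(u in halfline) (u `^ s * (1 + u) `^ (- (1 + a)))%:E)%E).
  rewrite le_eqVlt; apply/orP; left.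
  apply/eqP; apply: eq_integral => t /halflineP t0 /=.
  by rewrite ger0_norm ?mulr_ge0 ?powR_ge0 ?expR_ge0// ger0_norm//; lra.
by rewrite eGamma_beta_kernel// ltry.
Qed.

(** The derivative at s = 0 of the Beta integral
    int u^s (1 + u)^(- (1 + a)) du = Gamma (1 + s) Gamma (a - s) / Gamma (1 + a). *)
Lemma integral_kernel_ln (a : R) : 0 < a ->
  \int[mu]_(u in halfline) (ln u * (1 + u) `^ (- (1 + a))) =
  (dGamma 1 * Gamma a - dGamma a) / Gamma (1 + a).
Proof.
move=> a0.
pose w u : R := `|1 + u| `^ (- (1 + a)).
have [k [k0 ka k1]] : exists k : R, [/\ 0 < k, 2 * k < a & 2 * k < 1].
  by case: (leP a 1) => a1; [exists (a / 4)|exists (1 / 4)]; split; lra.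
have mw : measurable_fun [set: R] w.
  apply: (measurableT_comp (measurable_powR _)).
  apply: measurableT_comp => //.
  by apply: measurable_funD; [exact: measurable_cst|exact: measurable_id].
have w0 u : 0 <= w u by exact: powR_ge0.
have H1 : is_derive (0 : R) (1 : R) (fun x => \int[mu]_(u in halfline) (u `^ x * w u))
    (\int[mu]_(u in halfline) (ln u * (u `^ 0 * w u))).
  apply: (@mellin_derive w 0 k k0 mw w0).
    by apply: kernel_mellin_integrable; lra.
  by apply: kernel_mellin_integrable; lra.
have dp : is_derive (0 : R) (1 : R) (fun s : R => 1 + s) (0 + 1) by exact: is_deriveD.
have dm : is_derive (0 : R) (1 : R) (fun s : R => a - s) (0 - 1) by exact: is_deriveB.
have H2 : is_derive (0 : R) (1 : R) (fun s => Gamma (1 + s) * Gamma (a - s) / Gamma (1 + a))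
    ((dGamma 1 * Gamma a - dGamma a) / Gamma (1 + a)).
  have g1 : is_derive (1 + 0 : R) 1 (@Gamma R) (dGamma (1 + 0)).
    by apply: is_derive_Gamma; rewrite addr0.
  have ga : is_derive (a - 0 : R) 1 (@Gamma R) (dGamma (a - 0)).
    by apply: is_derive_Gamma; rewrite subr0.
  have G1 := @is_derive1_comp _ (@Gamma R) (fun s : R => 1 + s) 0 _ _ g1 dp.
  have G2 := @is_derive1_comp _ (@Gamma R) (fun s : R => a - s) 0 _ _ ga dm.
  have := is_deriveZ (Gamma (1 + a))^-1 (is_deriveM G1 G2).
  rewrite (_ : _ \*: _ = (fun s => Gamma (1 + s) * Gamma (a - s) / Gamma (1 + a))); last first.
    by apply/funext => s; rewrite [RHS]mulrC.
  move=> H; apply: (is_derive_eq H).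
  rewrite /GRing.scale/= addr0 subr0 Gamma1 mul1r sub0r add0r mulr1 mulrN1.
  by rewrite mulrC addrC (mulrC (Gamma a)).
have H3 : is_derive (0 : R) (1 : R) (fun s => Gamma (1 + s) * Gamma (a - s) / Gamma (1 + a))
    (\int[mu]_(u in halfline) (ln u * (u `^ 0 * w u))).
  apply: near_eq_is_derive H1; near=> s.
  have : `|s| < k by near: s; exact: near0_lt.
  rewrite ltr_norml => /andP[s1 s2]; apply/esym.
  have -> : Gamma (1 + s) * Gamma (a - s) / Gamma (1 + a) =
     fine (\int[mu]_(u in halfline) (u `^ s * (1 + u) `^ (- (1 + a)))%:E).
    by rewrite eGamma_beta_kernel//; lra.
  rewrite /Rintegral; congr fine; apply: eq_integral => u /halflineP u0.
  by rewrite /w ger0_norm//; lra.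
have <- := derive_val (is_derive := H2).
rewrite (derive_val (is_derive := H3)).
apply: eq_Rintegral => u /halflineP u0.
by rewrite powRr0 mul1r /w ger0_norm//; lra.
Unshelve. all: by end_near. Qed.

End gamma.

(** * The reflection formula *)

#[local] Opaque Gamma.

Section reflection.
Context {R : realType}.
Implicit Types (a x y : R).
Local Notation mu := (@lebesgue_measure R).
Local Notation I0pihalf := (`[0%R, pi / 2]%classic : set R).

Lemma norm_sin_le x : `|sin x| <= `|x|.
Proof.
wlog x0 : x / 0 <= x.
  move=> H; case: (leP 0 x) => x0; first exact: H.
  by rewrite -normrN -sinN -[leRHS]normrN H// oppr_ge0 ltW.
have [c _] := MVT_segment x0 (fun y _ => is_derive_sin y)
  (continuous_subspaceT (@continuous_sin R)).
rewrite sin0 !subr0 => ->; rewrite normrM ler_piMl//.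
exact: cos_max.
Qed.

Lemma onem_cosE x : 1 - cos x = 2 * sin (x / 2) ^+ 2.
Proof.
have -> : cos x = cos ((x / 2) *+ 2) by congr cos; rewrite -mulr_natr; field.
by rewrite cos_mulr2n sin2cos2 -mulr_natr; ring.
Qed.

Lemma onem_cos_ge0 x : 0 <= 1 - cos x.
Proof. by rewrite subr_ge0 cos_le1. Qed.

Lemma onem_cos_le x : 1 - cos x <= x ^+ 2 / 2.
Proof.
rewrite onem_cosE.
have : sin (x / 2) ^+ 2 <= (x / 2) ^+ 2.
  by rewrite -[leLHS]real_normK ?num_real// -[leRHS]real_normK ?num_real// lerXn2r ?nnegrE// norm_sin_le.
by rewrite exprMn -[2^-1 ^+ 2]/(2^-1 * 2^-1); lra.
Qed.

Lemma sinB_le x : `|sin x - x| <= x ^+ 2.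
Proof.
wlog x0 : x / 0 <= x.
  move=> H; case: (leP 0 x) => x0; first exact: H.
  have x1 : 0 <= - x by rewrite oppr_ge0 ltW.
  by have := H _ x1; rewrite sinN -opprD normrN sqrrN.
have [c] := MVT_segment x0 (fun y _ => is_derive_sin y)
  (continuous_subspaceT (@continuous_sin R)).
rewrite in_itv/= => /andP[c0 cx].
rewrite sin0 !subr0 => ->; rewrite -[X in _ - X]mul1r -mulrBl normrM expr2.
rewrite (ger0_norm x0) ler_wpM2r// distrC ger0_norm ?onem_cos_ge0//.
have [c1 _] := MVT_segment c0 (fun y _ => is_derive_cos y)
  (continuous_subspaceT (@continuous_cos R)).
rewrite cos0 subr0 => /eqP; rewrite subr_eq => /eqP ->.
rewrite opprD addrC subrK mulNr opprK.
apply: le_trans cx; rewrite -[leRHS]mul1r ler_wpM2r//; exact: sin_le1.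
Qed.

(** By the mean value theorem sin x / x = cos c for some c in [0, x]. *)
Lemma mulr_cos_le_sin x : 0 <= x <= pi / 2 -> x * cos x <= sin x.
Proof.
move=> /andP[x0 xp].
have [c] := MVT_segment x0 (fun y _ => is_derive_sin y)
  (continuous_subspaceT (@continuous_sin R)).
rewrite in_itv/= => /andP[c0 cx].
rewrite sin0 !subr0 => ->; rewrite mulrC ler_wpM2r//.
have pp := @pi_gt0 R.
move: cx; rewrite le_eqVlt => /predU1P[->//|cx].
by rewrite ltW// ltr_cos// in_itv/=; apply/andP; split; lra.
Qed.

Lemma segment_FTC2 (f F : R -> R) (a b : R) : a < b -> continuous f ->
  (forall x, is_derive x (1 : R) F (f x)) ->
  \int[mu]_(x in `[a, b]) f x = F b - F a.
Proof.
move=> ab cf dF; rewrite /Rintegral (continuous_FTC2 ab (F := F))//.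
- exact: continuous_subspaceT.
- split; first by move=> x _; exact: ex_derive.
    by apply: cvg_at_right_filter; exact: (is_derive_cvg (dF a)).
  by apply: cvg_at_left_filter; exact: (is_derive_cvg (dF b)).
- by move=> x _; rewrite derive1E; exact: derive_val.
Qed.

Lemma segment_integrable (f : R -> R) (a b : R) : continuous f ->
  mu.-integrable `[a, b] (EFin \o f).
Proof.
move=> cf; apply: continuous_compact_integrable; first exact: segment_compact.
exact: continuous_subspaceT.
Qed.

(** Wallis' integrals with a frequency x: cosint x (2 m) / cosint 0 (2 m) is the
    part k > m of the product of the 1 - (x / (2 k))^2 that represents
    sin (pi x / 2) / (pi x / 2). *)
Definition cosint x (n : nat) : R :=
  \int[mu]_(t in I0pihalf) (cos (x * t) * cos t ^+ n).

Lemma is_derive_cosZ x (t : R) :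
  is_derive t (1 : R) (fun t : R => cos (x * t)) (- (x * sin (x * t))).
Proof.
have dl : is_derive t (1 : R) (fun y : R => x * y) x.
  apply: (is_derive_eq (is_deriveZ x (is_derive_id t (1 : R)))).
  exact: mulr1.
have := @is_derive1_comp _ (@cos R) (fun y : R => x * y) t _ _ (is_derive_cos (x * t)) dl.
by rewrite mulNr mulrC.
Qed.

Lemma is_derive_sinZ x (t : R) :
  is_derive t (1 : R) (fun t : R => sin (x * t)) (x * cos (x * t)).
Proof.
have dl : is_derive t (1 : R) (fun y : R => x * y) x.
  apply: (is_derive_eq (is_deriveZ x (is_derive_id t (1 : R)))).
  exact: mulr1.
have := @is_derive1_comp _ (@sin R) (fun y : R => x * y) t _ _ (is_derive_sin (x * t)) dl.
by rewrite mulrC.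
Qed.

Lemma is_derive_cosX (t : R) n : is_derive t (1 : R) (fun t : R => cos t ^+ n.+1)
  (- (n.+1%:R * cos t ^+ n * sin t)).
Proof.
have H := is_deriveX n.+1 (is_derive_cos t).
have -> : (fun t : R => cos t ^+ n.+1) = cos ^+ n.+1 by rewrite exprfctE.
by apply: (is_derive_eq H); rewrite /GRing.scale/= mulrN.
Qed.

Lemma continuous_cosint x n : continuous (fun t : R => cos (x * t) * cos t ^+ n).
Proof.
move=> t; apply: cvgM; first exact: (is_derive_cvg (is_derive_cosZ x t)).
case: n => [|n].
  by under eq_fun do rewrite expr0; exact: cvg_cst.
exact: (is_derive_cvg (is_derive_cosX t n)).
Qed.

Lemma pihalf_gt0 : 0 < pi / 2 :> R.
Proof. by rewrite divr_gt0// pi_gt0. Qed.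

(** Two integrations by parts, packaged as one primitive F that vanishes at both
    ends of [0, pi/2]. *)
Lemma cosint_rec x n :
  n.+2%:R * n.+1%:R * cosint x n = (n.+2%:R ^+ 2 - x ^+ 2) * cosint x n.+2.
Proof.
(* f = F' is a combination of the two integrands once sin^2 = 1 - cos^2. *)
pose F t : R := n.+2%:R * (cos (x * t) * (cos t ^+ n.+1 * sin t)) -
  x * (sin (x * t) * cos t ^+ n.+2).
pose f t : R := (n.+2%:R ^+ 2 - x ^+ 2) * (cos (x * t) * cos t ^+ n.+2) -
  n.+2%:R * n.+1%:R * (cos (x * t) * cos t ^+ n).
have cf : continuous f.
  move=> t; apply: cvgB; apply: cvgM; try exact: cvg_cst; exact: continuous_cosint.
have dF t : is_derive t (1 : R) F (f t).
  have d1 := is_deriveZ n.+2%:R (is_deriveM (is_derive_cosZ x t)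
    (is_deriveM (is_derive_cosX t n) (is_derive_sin t))).
  have d2 := is_deriveZ x (is_deriveM (is_derive_sinZ x t) (is_derive_cosX t n.+1)).
  apply: (is_derive_eq (is_deriveB d1 d2)).
  rewrite /GRing.scale/= /f.
  set C := cos _; set S := sin (x * t).
  have := cos2Dsin2 t.
  set c := cos t; set s := sin t => e.
  rewrite [X in X * - (x * S)](_ : _ = c ^+ n.+1 * s)// (exprS c n.+1) (exprS c n).
  rewrite -!natr1; set k := c ^+ n.
  have es : s * s = 1 - c * c by rewrite -!expr2; lra.
  rewrite (_ : s * - _ = - ((n%:R + 1) * k) * (s * s)); last by ring.
  by rewrite es; ring.
have := segment_FTC2 pihalf_gt0 cf dF.
have -> : F (pi / 2) = 0 by rewrite /F cos_pihalf !expr0n/= !mul0r !mulr0 subrr.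
have -> : F 0 = 0 by rewrite /F !mulr0 sin0 mul0r !mulr0 subrr.
rewrite subrr.
have ck k m : mu.-integrable I0pihalf
    (EFin \o (fun t : R => k * (cos (x * t) * cos t ^+ m))).
  apply: segment_integrable => t; apply: cvgM; first exact: cvg_cst.
  exact: continuous_cosint.
rewrite /f RintegralB//.
rewrite !RintegralZl//; try by apply: segment_integrable; exact: continuous_cosint.
by move/eqP; rewrite subr_eq0 => /eqP.
Qed.

Lemma cosint00 : cosint 0 0 = pi / 2.
Proof.
rewrite /cosint (@eq_Rintegral _ _ _ _ _ (fun=> 1)); last first.
  by move=> t _; rewrite mul0r cos0 expr0 mulr1.
rewrite (segment_FTC2 pihalf_gt0 (F := id)) ?subr0//.
by move=> t; exact: cvg_cst.
Qed.

Lemma cosint0 x : 0 < x -> cosint x 0 = sin (x * (pi / 2)) / x.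
Proof.
move=> x0; rewrite /cosint.
have dF t : is_derive t (1 : R) (fun t => x^-1 * sin (x * t)) (cos (x * t) * cos t ^+ 0).
  apply: (is_derive_eq (is_deriveZ x^-1 (is_derive_sinZ x t))).
  by rewrite /GRing.scale/= mulrA mulVf ?gt_eqF// mul1r expr0 mulr1.
rewrite (segment_FTC2 pihalf_gt0 (@continuous_cosint x 0) dF).
by rewrite mulr0 sin0 mulr0 subr0 mulrC.
Qed.

Lemma cosint0_rec n : n.+1%:R * cosint 0 n = n.+2%:R * cosint 0 n.+2.
Proof.
have := cosint_rec 0 n; rewrite expr0n/= subr0 expr2 -!mulrA.
by apply: mulfI; rewrite pnatr_eq0.
Qed.

Lemma cosint0_gt0 m : 0 < cosint 0 m.*2.
Proof.
elim: m => [|m IH]; first by rewrite cosint00 pihalf_gt0.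
have := cosint0_rec m.*2; rewrite doubleS => e.
by rewrite -(@pmulr_rgt0 _ m.*2.+2%:R)// -e mulr_gt0.
Qed.

Lemma cosint_le x n : cosint x n <= cosint 0 n.
Proof.
apply: le_Rintegral => //; try by apply: segment_integrable; exact: continuous_cosint.
move=> t; rewrite /= in_itv/= => /andP[t0 tp].
rewrite ler_wpM2r//; last by rewrite mul0r cos0 cos_le1.
rewrite exprn_ge0// cos_ge0_pihalf// tp andbT.
by have := pihalf_gt0; lra.
Qed.

(** From 1 - cos (x t) <= (x t)^2 / 2 and (t cos t)^2 <= (sin t)^2 = 1 - (cos t)^2,
    the defect is controlled by cosint 0 n - cosint 0 (n + 2), which the recursion
    evaluates: it is O(1/n) relatively to the main term. *)
Lemma cosint_ge x n : cosint 0 n.+2 - x ^+ 2 / 2 * (cosint 0 n.+2 / n.+1%:R) <= cosint x n.+2.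
Proof.
have -> : cosint 0 n.+2 / n.+1%:R = cosint 0 n - cosint 0 n.+2.
  apply: (@mulfI _ n.+1%:R); first by rewrite pnatr_eq0.
  rewrite mulrBr cosint0_rec mulrCA divff ?pnatr_eq0// mulr1 -mulrBl.
  by rewrite -!natr1 [_ + 1 + 1]addrC addrK mul1r.
have ci y m := @segment_integrable _ 0 (pi / 2) (@continuous_cosint y m).
have ck k y m : mu.-integrable I0pihalf
    (EFin \o (fun t : R => k * (cos (y * t) * cos t ^+ m))).
  apply: segment_integrable => t; apply: cvgM; first exact: cvg_cst.
  exact: continuous_cosint.
rewrite -RintegralB// -RintegralZl//; last first.
  by apply: segment_integrable => t; apply: cvgB; exact: continuous_cosint.
rewrite -RintegralB//; last first.
  apply: segment_integrable => t; apply: cvgM; first exact: cvg_cst.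
  by apply: cvgB; exact: continuous_cosint.
apply: le_Rintegral => //.
  apply: segment_integrable => t; apply: cvgB; first exact: continuous_cosint.
  apply: cvgM; first exact: cvg_cst.
  by apply: cvgB; exact: continuous_cosint.
move=> t; rewrite /= in_itv/= => /andP[t0 tp].
rewrite mul0r cos0 !mul1r.
have c0 : 0 <= cos t by rewrite cos_ge0_pihalf// tp andbT; have := pihalf_gt0; lra.
have k0 : 0 <= cos t ^+ n by rewrite exprn_ge0.
have h1 : cos t ^+ n.+2 = cos t ^+ n * cos t ^+ 2 by rewrite -exprD addn2.
have h2 : (t * cos t) ^+ 2 <= sin t ^+ 2.
  rewrite lerXn2r ?nnegrE ?mulr_ge0//; last by rewrite mulr_cos_le_sin// t0.
  by rewrite sin_ge0_pi// t0/=; have := pihalf_gt0; lra.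
have h3 := onem_cos_le (x * t).
have h4 := cos2Dsin2 t.
rewrite lerBlDr -lerBlDl -{1}[cos t ^+ n.+2]mul1r -mulrBl.
apply: (@le_trans _ _ ((x * t) ^+ 2 / 2 * cos t ^+ n.+2)).
  by rewrite ler_wpM2r// exprn_ge0.
rewrite h1 exprMn [_ * _ / 2]mulrAC -[leLHS]mulrA ler_wpM2l//.
  by rewrite divr_ge0// sqr_ge0.
rewrite -{2}(mulr1 (cos t ^+ n)) -mulrBr mulrCA ler_wpM2l//.
by move: h2; rewrite exprMn; lra.
Qed.

#[local] Opaque cosint.

(** Young's inequality between t and 1. *)
Lemma powR_le_interpol (t a : R) : 0 <= t -> 0 < a < 1 -> t `^ a <= (1 - a) + a * t.
Proof.
move=> t0 /andP[a0 a1].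
have a1' : 0 < (1 - a)^-1 by rewrite invr_gt0 subr_gt0.
have a0' : 0 < a^-1 by rewrite invr_gt0.
have e : a^-1^-1 + (1 - a)^-1^-1 = 1 by rewrite !invrK addrC subrK.
have := conjugate_powR (powR_ge0 t a) ler01 a0' a1' e.
by rewrite mulr1 -powRrM mulfV ?gt_eqF// powRr1// powR1 !invrK mul1r mulrC addrC.
Qed.

(** Interpolating t^a = x^a (t / x)^a linearly between the exponents 0 and 1 is
    sharp at t = x, near which the weight t^(x - 1) e^(- t) concentrates for
    large x. *)
Lemma eGamma_log_convex x a : 0 < x -> 0 < a < 1 ->
  (eGamma (x + a) <= (x `^ a * (1 - a))%:E * eGamma x +
                     (x `^ a * (a / x))%:E * eGamma (x + 1))%E.
Proof.
move=> x0 a01; have /andP[a0 a1] := a01.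
have mg y : measurable_fun [set: R] (fun t : R => t `^ (y - 1) * expR (- t)).
  apply: measurable_funM; first exact: measurable_powR.
  exact: measurableT_comp.
have g0 y (t : R) : 0 <= t `^ (y - 1) * expR (- t).
  by rewrite mulr_ge0 ?powR_ge0 ?expR_ge0.
have mD : measurable (`]0%R, +oo[%classic : set R) by [].
have k1 : 0 <= x `^ a * (1 - a) by rewrite mulr_ge0 ?powR_ge0// subr_ge0 ltW.
have k2 : 0 <= x `^ a * (a / x) by rewrite !mulr_ge0 ?powR_ge0 ?invr_ge0 ?ltW.
rewrite -(ge0_integralZlR mu mD k1 (g0 x) (mg x)).
rewrite -(ge0_integralZlR mu mD k2 (g0 (x + 1)) (mg (x + 1))).
rewrite -ge0_integralD//; first last.
- apply: measurable_funTS; apply/measurable_EFinP.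
  by apply: measurable_funM => //; exact: mg.
- by move=> t _; rewrite lee_fin mulr_ge0.
- apply: measurable_funTS; apply/measurable_EFinP.
  by apply: measurable_funM => //; exact: mg.
- by move=> t _; rewrite lee_fin mulr_ge0.
apply: ge0_le_integral => //.
- by move=> t _; rewrite lee_fin.
- by apply: measurable_funTS; apply/measurable_EFinP; exact: mg.
- apply: measurable_funTS; apply: emeasurable_funD; apply/measurable_EFinP;
  by apply: measurable_funM => //; exact: mg.
move=> t /mem_set/halflineP t0; rewrite -EFinD lee_fin.
rewrite addrAC (gt0_powRD (x - 1) a t0) [x + 1 - 1]addrAC (gt0_powRD (x - 1) 1 t0) (powRr1 (ltW t0)).
have h := powR_le_interpol (divr_ge0 (ltW t0) (ltW x0)) a01.
have -> : t `^ a = x `^ a * (t / x) `^ a.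
  rewrite -powRM ?divr_ge0 ?ltW//; congr (_ `^ _).
  by rewrite mulrCA divff ?gt_eqF// mulr1.
apply: (@le_trans _ _ (t `^ (x - 1) * (x `^ a * (1 - a + a * (t / x))) * expR (- t))).
  rewrite ler_wpM2r ?expR_ge0// ler_wpM2l ?powR_ge0// ler_wpM2l ?powR_ge0//.
by rewrite le_eqVlt; apply/orP; left; apply/eqP; ring.
Qed.

Lemma Gamma_log_convex x a : 0 < x -> 0 < a < 1 ->
  Gamma (x + a) <= x `^ a * Gamma x.
Proof.
move=> x0 a01; have /andP[a0 a1] := a01.
have xa0 : 0 < x + a by exact: addr_gt0.
have x10 : 0 < x + 1 by exact: addr_gt0.
have := eGamma_log_convex x0 a01.
rewrite (eGammaE xa0) (eGammaE x0) (eGammaE x10) (GammaD1 x0) lee_fin.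
move=> /le_trans; apply; rewrite le_eqVlt; apply/orP; left; apply/eqP.
by move: (Gamma x) (x `^ a) => g p; field; rewrite gt_eqF.
Qed.

Lemma gt0_powR_onem (a y : R) : 0 < y -> y `^ a * y `^ (1 - a) = y.
Proof. by move=> y0; rewrite -gt0_powRD// addrCA subrr addr0 powRr1// ltW. Qed.

(** Writing n and n + 1 as products of powers with exponents a and 1 - a, the
    two sides compare factor by factor. *)
Lemma powR_ratio_le (n a : R) : 0 < n -> 0 < a < 1 ->
  n * (n + 1 - a) `^ a <= (n + 1) * (n + a) `^ a.
Proof.
move=> n0 /andP[a0 a1].
have [a0' a1' n0' n1'] : [/\ 0 <= a, 0 <= 1 - a, 0 <= n & 0 <= n + 1] by split; lra.
have [h1 h2 h3] : [/\ n <= n + a, n + 1 - a <= n + 1 & n <= n + 1] by split; lra.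
have [h4 h5] : 0 <= n + 1 - a /\ 0 <= n + a by split; lra.
have pD (y : R) : 0 <= y -> y `^ a * y `^ (1 - a) = y.
  rewrite le_eqVlt => /predU1P[<-|y0].
    by rewrite powR0 ?mul0r ?gt_eqF.
  exact: gt0_powR_onem.
rewrite -[X in X * (_ - _) `^ a <= _](pD _ n0').
rewrite -[X in _ <= X * _](pD _ n1').
have -> : n `^ a * n `^ (1 - a) * (n + 1 - a) `^ a =
  n `^ (1 - a) * (n `^ a * (n + 1 - a) `^ a) by rewrite mulrA [n `^ _ * _]mulrC.
have -> : (n + 1) `^ a * (n + 1) `^ (1 - a) * (n + a) `^ a =
  (n + 1) `^ (1 - a) * ((n + a) `^ a * (n + 1) `^ a).
  by rewrite mulrAC mulrC [(n + 1) `^ a * _]mulrC.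
have mono (b y z : R) : 0 <= b -> 0 <= y -> 0 <= z -> y <= z -> y `^ b <= z `^ b.
  by move=> b0 y0 z0 yz; apply: ge0_ler_powR.
apply: ler_pM; [exact: powR_ge0|by rewrite mulr_ge0// powR_ge0|exact: mono|].
by apply: ler_pM; [exact: powR_ge0|exact: powR_ge0|exact: mono|exact: mono].
Qed.

Lemma powR_split_le (n a : R) : 0 < n -> 0 < a < 1 ->
  (n + 1) `^ a * n `^ (1 - a) <= n + 1.
Proof.
move=> n0 /andP[a0 a1].
have [a1' n0' n1' h] : [/\ 0 <= 1 - a, 0 <= n, 0 < n + 1 & n <= n + 1] by split; lra.
rewrite -[leRHS](gt0_powR_onem a n1'); apply: ler_wpM2l; first exact: powR_ge0.
by apply: ge0_ler_powR => //; rewrite nnegrE ltW.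
Qed.

(** Elementary form of the first bound of [Gamma_ratio_bounds], with the values
    of Gamma replaced by free reals. *)
Lemma ratio_lower (n g ga gb u v : R) : 0 < n + 1 -> 0 < g -> 0 <= ga ->
  0 < v -> 0 <= u -> u * g <= ga -> g <= v * gb -> n * v <= (n + 1) * u ->
  n / (n + 1) <= ga * gb / g ^+ 2.
Proof.
move=> n1 g0 ga0 v0 u0 h1 h2 h3.
have g2 : 0 < g ^+ 2 by rewrite exprn_gt0.
rewrite ler_pdivrMr// mulrAC ler_pdivlMr// -(ler_pM2r v0).
apply: (@le_trans _ _ ((n + 1) * u * g ^+ 2)).
  by rewrite mulrAC ler_wpM2r// ltW.
apply: (@le_trans _ _ ((n + 1) * (ga * (v * gb)))); last first.
  by rewrite le_eqVlt; apply/orP; left; apply/eqP; ring.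
rewrite -mulrA ler_wpM2l ?(ltW n1)// expr2 mulrA.
apply: ler_pM => //; last exact: ltW.
by rewrite mulr_ge0// ltW.
Qed.

(** Elementary form of the second bound of [Gamma_ratio_bounds]. *)
Lemma ratio_upper (n g ga gb u v : R) : 0 < n -> 0 < g -> 0 <= ga ->
  0 <= gb -> ga <= u * g -> n * gb <= v * g -> u * v <= n + 1 ->
  ga * gb / g ^+ 2 <= (n + 1) / n.
Proof.
move=> n0 g0 ga0 gb0 h1 h2 h3.
have g2 : 0 < g ^+ 2 by rewrite exprn_gt0.
rewrite ler_pdivlMr// mulrAC ler_pdivrMr//.
apply: (@le_trans _ _ (u * g * (v * g))).
  rewrite -[ga * gb * n]mulrA [gb * n]mulrC; apply: ler_pM => //.
  by rewrite mulr_ge0// ltW.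
by rewrite mulrACA -expr2 ler_wpM2r// ltW.
Qed.

(** Log-convexity between neighbouring arguments, used in both directions: the
    quotient tends to 1, at rate 1/m. *)
Lemma Gamma_ratio_bounds a m : 0 < a < 1 -> (0 < m)%N ->
  m%:R / (m%:R + 1) <=
    Gamma (m%:R + 1 + a) * Gamma (m%:R + 1 - a) / Gamma (m%:R + 1) ^+ 2
    <= (m%:R + 1) / m%:R.
Proof.
move=> a01 m0; have /andP[a0 a1] := a01.
have : 0 < m%:R :> R by rewrite ltr0n.
move: (m%:R : R) => n {m m0} n0.
have b01 : 0 < 1 - a < 1 by apply/andP; split; lra.
have [n1 na nb nc] : [/\ 0 < n + 1, 0 < n + a, 0 < n + 1 - a & 0 < n + 1 + a].
  by split; lra.
have e1 : n + a + (1 - a) = n + 1 by ring.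
have e2 : n + 1 - a + a = n + 1 by ring.
have e3 : n + a + 1 = n + 1 + a by ring.
have e4 : n + (1 - a) = n + 1 - a by ring.
have h1 := Gamma_log_convex na b01; rewrite e1 in h1.
have h2 := Gamma_log_convex nb a01; rewrite e2 in h2.
have h3 := GammaD1 na; rewrite e3 in h3.
have h4 := Gamma_log_convex n1 a01.
have h5 := Gamma_log_convex n0 b01; rewrite e4 in h5.
have h6 := GammaD1 n0.
have g1 := Gamma_gt0 n1; have ga := ltW (Gamma_gt0 nc).
have gb := ltW (Gamma_gt0 nb).
have v0 : 0 < (n + 1 - a) `^ a by rewrite powR_gt0.
have pD := gt0_powR_onem a na.
apply/andP; split.
  apply: (ratio_lower n1 g1 ga v0 (powR_ge0 (n + a) a) _ h2 (powR_ratio_le n0 a01)).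
  rewrite h3 -[X in _ <= X * _]pD -mulrA.
  by apply: ler_wpM2l; [exact: powR_ge0|exact: h1].
apply: (ratio_upper n0 g1 ga gb h4 _ (powR_split_le n0 a01)).
by rewrite h6 mulrCA; apply: ler_wpM2l; [exact: ltW|exact: h5].
Qed.

(** Both factors on the right change by mutually inverse rational factors when m
    grows by one, by the functional equation and by the recursion for [cosint];
    at m = 0 the integrals are explicit. *)
Lemma Gamma_reflection_wallis a m : 0 < a < 1 ->
  Gamma a * Gamma (1 - a) * sin (pi * a) / pi =
  Gamma (m%:R + 1 + a) * Gamma (m%:R + 1 - a) / Gamma (m%:R + 1) ^+ 2 *
  (cosint (2 * a) m.*2 / cosint 0 m.*2).
Proof.
move=> /andP[a0 a1].
have pi0 := @pi_gt0 R.
elim: m => [|m ->].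
  rewrite !add0r Gamma1 expr1n divr1 cosint00 cosint0 ?mulr_gt0//.
  rewrite [1 + a]addrC GammaD1//.
  rewrite (_ : 2 * a * (pi / 2) = pi * a); last by rewrite mulrCA mulrAC divff ?mul1r// pnatr_eq0.
  move: (Gamma a) (Gamma (1 - a)) (sin (pi * a)) (pi : R) pi0 => x y z p p0.
  by field; rewrite (gt_eqF a0) (gt_eqF p0).
have c1 := cosint_rec (2 * a) m.*2.
have c2 := cosint0_rec m.*2.
have c0 := cosint0_gt0 m.
have n0 : 0 <= m%:R :> R by rewrite ler0n.
have en : m.+1%:R = m%:R + 1 :> R by rewrite natr1.
have en1 : m.*2.+1%:R = 2 * m%:R + 1 :> R by rewrite -natr1 -mul2n natrM.
have en2 : m.*2.+2%:R = 2 * m%:R + 2 :> R by rewrite -addn2 natrD -mul2n natrM.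
rewrite doubleS en; rewrite en1 en2 in c1 c2.
move: (m%:R : R) n0 c1 c2 {en en1 en2} => n n0 c1 c2.
have k0 : 2 * n + 2 != 0 by rewrite gt_eqF//; lra.
have e1 : cosint 0 m.*2.+2 = (2 * n + 1) / (2 * n + 2) * cosint 0 m.*2.
  by apply: (mulfI k0); rewrite -c2 mulrA mulrCA divff// mulr1.
have q0 : 0 < (n + 1) ^+ 2 - a ^+ 2.
  by rewrite subr_gt0 ltrXn2r ?nnegrE//; lra.
have e2 : cosint (2 * a) m.*2.+2 =
    (2 * n + 2) * (2 * n + 1) / (4 * ((n + 1) ^+ 2 - a ^+ 2)) * cosint (2 * a) m.*2.
  have q4 : (2 * n + 2) ^+ 2 - (2 * a) ^+ 2 = 4 * ((n + 1) ^+ 2 - a ^+ 2) by ring.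
  rewrite q4 in c1; apply: (@mulfI _ (4 * ((n + 1) ^+ 2 - a ^+ 2))).
    by rewrite gt_eqF// mulr_gt0.
  by rewrite -c1 mulrA mulrCA divff ?mulr1// gt_eqF// mulr_gt0.
rewrite e1 e2.
have -> : n + 1 + 1 + a = (n + 1 + a) + 1 by ring.
have -> : n + 1 + 1 - a = (n + 1 - a) + 1 by ring.
have p1 : 0 < n + 1 + a by lra.
have p2 : 0 < n + 1 - a by lra.
have p3 : 0 < n + 1 by lra.
rewrite (GammaD1 p1) (GammaD1 p2) (GammaD1 p3).
have g1 : 0 < Gamma (n + 1) by exact: Gamma_gt0.
move: (Gamma (n + 1)) (Gamma (n + 1 + a)) (Gamma (n + 1 - a)) g1 => g ga gb g0.
move: (cosint 0 _) c0 (cosint (2 * a) _) {e1 e2 c1 c2} => c c0 w.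
have k1 : 0 < 2 * n + 1 by lra.
have k2 : 0 < 2 * n + 2 by lra.
by field; rewrite (gt_eqF c0) (gt_eqF g0) (gt_eqF p3) (gt_eqF q0) (gt_eqF k1) (gt_eqF k2).
Qed.

(** In the identity above the two factors on the right tend to 1 as m grows;
    the bounds are kept explicit, as 1 - 4/m and 1 + 4/m. *)
Lemma Gamma_reflection a : 0 < a < 1 ->
  Gamma a * Gamma (1 - a) * sin (pi * a) = pi.
Proof.
move=> a01; have /andP[a0 a1] := a01.
have pi0 := @pi_gt0 R.
suff : Gamma a * Gamma (1 - a) * sin (pi * a) / pi = 1.
  by move/(congr1 (fun x => x * pi)); rewrite divfK ?gt_eqF// mul1r.
set L := LHS.
have bnd m : (1 < m)%N -> 1 - 4 / m%:R <= L /\ L <= 1 + 4 / m%:R.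
  case: m => [//|m] m0; rewrite /L (Gamma_reflection_wallis m.+1 a01).
  have /andP[] := Gamma_ratio_bounds a01 (ltn0Sn m).
  set Q := Gamma _ * _ / _; set W := cosint _ _ / _.
  have c0 := cosint0_gt0 m.+1.
  have w1 : W <= 1 by rewrite /W ler_pdivrMr// mul1r; exact: cosint_le.
  have w2 : 1 - 2 / m.+1%:R <= W.
    rewrite /W ler_pdivlMr// doubleS; apply: le_trans (cosint_ge _ _).
    rewrite doubleS in c0; move: (cosint 0 _) c0 => c c0.
    rewrite mulrBl mul1r lerB// mulrA mulrAC ler_wpM2r ?(ltW c0)//.
    apply: (@le_trans _ _ (2 / m.*2.+1%:R)).
      rewrite ler_wpM2r ?invr_ge0//.
      rewrite exprMn -[2 ^+ 2]/(2 * 2) mulrAC mulfK ?pnatr_eq0//.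
      by rewrite ler_piMr// exprn_ile1// ltW.
    by rewrite ler_wpM2l// lef_pV2 ?posrE ?ltr0n// ler_nat ltnS -addnn leq_addr.
  clearbody Q W; clear c0 L.
  have : 2 <= m.+1%:R :> R by rewrite ler_nat.
  move: (m.+1%:R : R) w2 => n w2 n2 q1 q2.
  have n0 : 0 < n by lra.
  have n1 : 0 < n + 1 by lra.
  have Q0 : 0 <= Q by apply: le_trans q1; rewrite divr_ge0// ltW.
  have u0 : 0 <= 1 - 2 / n by rewrite subr_ge0 ler_pdivrMr// mul1r.
  split.
    apply: (@le_trans _ _ (n / (n + 1) * (1 - 2 / n))).
      have -> : n / (n + 1) * (1 - 2 / n) = 1 - 3 / (n + 1).
        by field; rewrite !gt_eqF.
      rewrite lerB//; apply: ler_pM => //; rewrite ?invr_ge0 ?(ltW n1)//; first by lra.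
      by rewrite lef_pV2 ?posrE//; lra.
    by apply: ler_pM => //; rewrite divr_ge0// ltW.
  apply: (@le_trans _ _ ((n + 1) / n)); last first.
    by rewrite mulrDl divff ?gt_eqF// lerD2l ler_wpM2r ?invr_ge0 ?(ltW n0)//; lra.
  by apply: le_trans q2; rewrite -[leRHS]mulr1 ler_wpM2l.
clearbody L.
have small (e : R) : 0 < e -> exists2 m, (1 < m)%N & 4 / m%:R <= e.
  move=> e0; exists (Num.truncn (4 / e)).+2 => //.
  rewrite ler_pdivrMr ?ltr0n// mulrC -ler_pdivrMr//.
  apply: ltW; apply: lt_trans (truncnS_gt _) _.
  by rewrite ltr_nat.
apply/eqP; rewrite eq_le; apply/andP; split; apply/ler_addgt0Pr => e e0.
  have [m m1 me] := small e e0; have [_ h] := bnd m m1.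
  by apply: (le_trans h); rewrite lerD2l.
have [m m1 me] := small e e0; have [h _] := bnd m m1.
by rewrite -lerBlDr; apply: le_trans h; rewrite lerB.
Qed.

Lemma sin_pi_gt0 a : 0 < a < 1 -> 0 < sin (pi * a).
Proof.
move=> /andP[a0 a1]; have p0 := @pi_gt0 R.
by rewrite sin_gt0_pi// mulr_gt0//= gtr_pMr.
Qed.

Lemma is_derive_unique (f : R -> R) (x u v : R) :
  is_derive x (1 : R) f u -> is_derive x (1 : R) f v -> u = v.
Proof. by move=> [_ <-] [_ <-]. Qed.

(** The logarithmic derivative of the reflection formula. *)
Lemma dGamma_reflection a : 0 < a < 1 ->
  dGamma (1 - a) / Gamma (1 - a) - dGamma a / Gamma a = pi * cot (pi * a).
Proof.
move=> a01; have /andP[a0 a1] := a01.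
have b0 : 0 < 1 - a by rewrite subr_gt0.
have dm : is_derive a (1 : R) (fun s : R => 1 - s) (0 - 1) by exact: is_deriveB.
have d1 := is_derive_Gamma a0.
have d2 := @is_derive1_comp _ (@Gamma R) (fun s : R => 1 - s) a _ _ (is_derive_Gamma b0) dm.
have d3 := is_derive_sinZ pi a.
have d := is_deriveM (is_deriveM d1 d2) d3.
have d0 : is_derive a (1 : R) (Gamma * (Gamma \o (fun s : R => 1 - s)) * (fun t : R => sin (pi * t))) 0.
  apply: near_eq_is_derive (is_derive_cst (pi : R) a (1 : R)).
  near=> s; apply/esym; apply: Gamma_reflection; apply/andP; split.
    by near: s; exact: lt_nbhsr.
  by near: s; exact: lt_nbhsl.
have := is_derive_unique d d0.
rewrite /GRing.scale/= /cot.
have s0 := sin_pi_gt0 a01.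
have ga := Gamma_gt0 a0; have gb := Gamma_gt0 b0.
rewrite sub0r.
rewrite [X in X * (pi * _)](_ : _ = Gamma a * Gamma (1 - a))//.
move: (sin (pi * a)) (cos (pi * a)) s0 => s c s0.
move: (Gamma a) (Gamma (1 - a)) (dGamma a) (dGamma (1 - a)) (pi : R) ga gb.
move=> g h dg dh p g0 h0 e.
apply: (@mulfI _ (g * h * s)); first by rewrite !mulf_neq0// gt_eqF.
have -> : g * h * s * (p * (c / s)) = g * h * (p * c) by field; rewrite gt_eqF.
have -> : g * h * s * (dh / h - dg / g) = s * (dh * g - h * dg) by field; rewrite !gt_eqF.
lra.
Unshelve. all: by end_near. Qed.

End reflection.

(** * Dyadic sums of cosines *)

Section dyadic_cosine_sums.
Context {R : realType}.
Implicit Types (x : R).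

(** The weights 2^k make the sum of |e / 2^k| grow linearly with n, while that of
    (e / 2^k)^2 stays bounded: the sums see first-order behaviour at 0 only. *)
Definition dyadic (f : R -> R) (e : R) (n : nat) : R :=
  \sum_(k < n) 2 ^+ k * f (e / 2 ^+ k).

Lemma dyadicS f e n : dyadic f e n.+1 = f e + 2 * dyadic f (e / 2) n.
Proof.
rewrite /dyadic big_ord_recl/= expr0 mul1r divr1; congr (_ + _).
rewrite mulr_sumr; apply: eq_bigr => k _.
by rewrite mulrA -exprS exprS invfM mulrA.
Qed.

(** The bound f x = 6 |x| satisfies f x = 2 f (x / 2) and leaves no room for the
    new term of the induction; the smaller 6 x^2 / (|x| + 2) does. *)
Lemma dyadic_onem_cos_le x n :
  dyadic (fun y => 1 - cos y) x n <= 6 * x ^+ 2 / (`|x| + 2).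
Proof.
elim: n x => [|n IH] x.
  by rewrite /dyadic big_ord0 divr_ge0// ?addr_ge0// mulr_ge0// sqr_ge0.
rewrite dyadicS; apply: (@le_trans _ _ (1 - cos x + 2 * (6 * (x / 2) ^+ 2 / (`|x / 2| + 2)))).
  by rewrite lerD2l ler_wpM2l.
have -> : `|x / 2| = `|x| / 2 by rewrite normrM [ `|2^-1| ]ger0_norm.
have : 1 - cos x <= 2 by have := cos_geN1 x; lra.
have := onem_cos_le x.
rewrite -[x ^+ 2]real_normK ?num_real// exprMn -[x ^+ 2]real_normK ?num_real//.
have := normr_ge0 x; move: `|x| (1 - cos x) => a c a0 h1 h2.
rewrite [leRHS](_ : _ = 12 * a ^+ 2 / ((a + 2) * (a + 4)) + 6 * a ^+ 2 / (a + 4)); last first.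
  by field; rewrite !gt_eqF//; lra.
rewrite [X in _ + X](_ : _ = 6 * a ^+ 2 / (a + 4)); last first.
  by field; rewrite !gt_eqF//; lra.
rewrite lerD2r ler_pdivlMr; last by rewrite mulr_gt0; lra.
have [a2|a2] := leP a 2.
  apply: (@le_trans _ _ (a ^+ 2 / 2 * ((a + 2) * (a + 4)))).
    by rewrite ler_wpM2r// mulr_ge0; lra.
  rewrite -[12 * _]mulrC -mulrA ler_wpM2l ?sqr_ge0//.
  by nra.
apply: (@le_trans _ _ (2 * ((a + 2) * (a + 4)))).
  by rewrite ler_wpM2r// mulr_ge0; lra.
by nra.
Qed.

Lemma dyadic_onem_cos_le_norm x n :
  dyadic (fun y => 1 - cos y) x n <= 6 * `|x|.
Proof.
apply: (le_trans (dyadic_onem_cos_le x n)).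
rewrite -[x ^+ 2]real_normK ?num_real//; have := normr_ge0 x.
move: `|x| => a a0; rewrite ler_pdivrMr; last by lra.
nra.
Qed.

Lemma onem_cos_half_gt0 : 0 < 1 - cos (1 / 2) :> R.
Proof.
rewrite subr_gt0 -[ltRHS]cos0 ltr_cos ?in_itv/=; [lra| |];
by have := @pi_ge2 R; lra.
Qed.

Lemma dyadic_onem_cos_ge0 x n : 0 <= dyadic (fun y => 1 - cos y) x n.
Proof.
by rewrite /dyadic sumr_ge0// => k _; rewrite mulr_ge0 ?exprn_ge0 ?onem_cos_ge0.
Qed.

(** Halving x until it lies in [1/2, 1[ reaches the term 2^k (1 - cos (x / 2^k)),
    which alone exceeds the lower bound. *)
Lemma dyadic_onem_cos_ge x n : 1 / 2 <= `|x| < 2 ^+ n ->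
  (1 - cos (1 / 2)) * `|x| <= dyadic (fun y => 1 - cos y) x n.+1.
Proof.
have c0 := onem_cos_half_gt0.
have small (y : R) : 1 / 2 <= `|y| < 1 -> (1 - cos (1 / 2)) * `|y| <= 1 - cos y.
  move=> /andP[y1 y2]; apply: (@le_trans _ _ (1 - cos (1 / 2))).
    by rewrite ler_piMr// ltW.
  rewrite lerB// -[cos y]cos_norm.
  move: y1; rewrite le_eqVlt => /predU1P[->//|y1].
  by rewrite ltW// ltr_cos ?in_itv//=; have := @pi_ge2 R; lra.
elim: n x => [|n IH] x /andP[x1 x2].
  rewrite dyadicS /dyadic big_ord0 mulr0 addr0; apply: small.
  by rewrite x1.
rewrite dyadicS; have [h|h] := ltP `|x| 1.
  apply: (@le_trans _ _ (1 - cos x)); first by apply: small; rewrite x1.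
  by rewrite lerDl mulr_ge0// dyadic_onem_cos_ge0.
have nx : `|x / 2| = `|x| / 2 by rewrite normrM [ `|2^-1| ]ger0_norm.
apply: (@le_trans _ _ (2 * dyadic (fun y => 1 - cos y) (x / 2) n.+1)); last first.
  by rewrite lerDr onem_cos_ge0.
have := IH (x / 2); rewrite nx => H.
apply: (@le_trans _ _ (2 * ((1 - cos (1 / 2)) * (`|x| / 2)))).
  by rewrite le_eqVlt; apply/orP; left; apply/eqP; field.
rewrite ler_wpM2l// H// ltr_pdivrMr// -exprSr x2 andbT; lra.
Qed.

Lemma dyadic_sqr (e : R) n : dyadic (fun y => y ^+ 2) e n <= 2 * e ^+ 2.
Proof.
elim: n e => [|n IH] e; first by rewrite /dyadic big_ord0 mulr_ge0 ?sqr_ge0.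
rewrite dyadicS; have := IH (e / 2); rewrite exprMn -[2^-1 ^+ 2]/(2^-1 * 2^-1).
lra.
Qed.

(** For f = 1 - Re (E exp (i y X)), this says that X has a finite first moment. *)
Definition dyadic_bounded (f : R -> R) (e : R) := exists M, forall n, dyadic f e n <= M.

(** Errors of second order are harmless, since the dyadic sums of y^2 are
    bounded. *)
Lemma dyadic_bounded_le (f g : R -> R) (e K L : R) : 0 < e -> 0 <= K -> 0 <= L ->
  (forall y, 0 < y <= e -> f y <= K * g y + L * y ^+ 2) ->
  dyadic_bounded g e -> dyadic_bounded f e.
Proof.
move=> e0 K0 L0 fg [M gM]; exists (K * M + L * (2 * e ^+ 2)) => n.
apply: (@le_trans _ _ (K * dyadic g e n + L * dyadic (fun y => y ^+ 2) e n)).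
  rewrite /dyadic !mulr_sumr -big_split/=; apply: ler_sum => k _.
  rewrite mulrCA [L * _]mulrCA -mulrDr ler_wpM2l ?exprn_ge0//.
  apply: fg; rewrite divr_gt0 ?exprn_gt0//= ler_pdivrMr ?exprn_gt0//.
  by rewrite ler_peMr ?(ltW e0)// exprn_ege1// ler1n.
by apply: lerD; rewrite ler_wpM2l// dyadic_sqr.
Qed.

End dyadic_cosine_sums.

(** * Cosine and sine transforms *)

Section moments.
Context {R : realType} d (T : measurableType d) (m : {measure set T -> \bar R}).
Variables (D : set T) (mD : measurable D).
Implicit Types (Y w : T -> R).

(** The weight w serves for the Gamma integrals, where Y = ln and w is the real
    integrand; for Fourier transforms of measures w = 1. *)
Definition cos_transform w Y (y : R) : R := \int[m]_(t in D) (w t * cos (y * Y t)).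
Definition sin_transform w Y (y : R) : R := \int[m]_(t in D) (w t * sin (y * Y t)).

Lemma integrable_weight w (g : T -> R) : measurable_fun D g ->
  (forall t, `|g t| <= 1) ->
  m.-integrable D (EFin \o w) -> m.-integrable D (EFin \o (fun t => w t * g t)).
Proof.
move=> mg g1 iw.
apply: (@le_integrable _ _ _ m D mD _ (EFin \o w)) => //.
  apply/measurable_EFinP; apply: measurable_funM => //.
  by apply/measurable_EFinP; exact: (measurable_int m).
move=> t _; rewrite /= lee_fin normrM ler_piMr//.
Qed.

Lemma measurable_cosZ Y y : measurable_fun D Y -> measurable_fun D (fun t => cos (y * Y t)).
Proof.
move=> mY; apply: (measurableT_comp (continuous_measurable_fun (@continuous_cos R))).
exact: measurable_funM.
Qed.

Lemma measurable_sinZ Y y : measurable_fun D Y -> measurable_fun D (fun t => sin (y * Y t)).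
Proof.
move=> mY; apply: (measurableT_comp (continuous_measurable_fun (@continuous_sin R))).
exact: measurable_funM.
Qed.

Lemma integrable_cos w Y y : measurable_fun D Y -> m.-integrable D (EFin \o w) ->
  m.-integrable D (EFin \o (fun t => w t * cos (y * Y t))).
Proof.
move=> mY iw; apply: integrable_weight => //; first exact: measurable_cosZ.
by move=> t; exact: cos_max.
Qed.

Lemma integrable_sin w Y y : measurable_fun D Y -> m.-integrable D (EFin \o w) ->
  m.-integrable D (EFin \o (fun t => w t * sin (y * Y t))).
Proof.
move=> mY iw; apply: integrable_weight => //; first exact: measurable_sinZ.
by move=> t; exact: sin_max.
Qed.

Lemma cos_transform0 w Y : cos_transform w Y 0 = \int[m]_(t in D) w t.
Proof. by apply: eq_Rintegral => t _; rewrite mul0r cos0 mulr1. Qed.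

Lemma sin_transform0 w Y : sin_transform w Y 0 = 0.
Proof.
rewrite /sin_transform (@eq_Rintegral _ _ _ _ _ (fun=> 0)).
  by rewrite Rintegral_cst// mul0r.
by move=> t _; rewrite mul0r sin0 mulr0.
Qed.

Lemma cos_transform_expansion w Y y : (forall t, 0 <= w t) ->
  measurable_fun D Y -> m.-integrable D (EFin \o w) ->
  m.-integrable D (EFin \o (fun t => Y t ^+ 2 * w t)) ->
  `|cos_transform w Y y - \int[m]_(t in D) w t| <=
    y ^+ 2 * \int[m]_(t in D) (Y t ^+ 2 * w t).
Proof.
move=> w0 mY iw iY2; have ic := integrable_cos y mY iw.
rewrite -RintegralB//; apply: (le_trans (le_normr_Rintegral mD _)).
  exact: (integrableB _ ic iw).
rewrite -RintegralZl//; apply: le_Rintegral => //.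
- exact: (integrable_norm (integrableB mD ic iw)).
- exact: (integrableZl mD (y ^+ 2) iY2).
move=> t _; rewrite -[X in _ - X]mulr1 -mulrBr normrM ger0_norm// [leLHS]mulrC mulrA.
rewrite ler_wpM2r// -exprMn distrC ger0_norm ?onem_cos_ge0//.
apply: (le_trans (onem_cos_le _)).
by rewrite ler_pdivrMr// ler_peMr ?sqr_ge0// ler1n.
Qed.

Lemma sin_transform_expansion w Y y : (forall t, 0 <= w t) ->
  measurable_fun D Y -> m.-integrable D (EFin \o w) ->
  m.-integrable D (EFin \o (fun t => Y t * w t)) ->
  m.-integrable D (EFin \o (fun t => Y t ^+ 2 * w t)) ->
  `|sin_transform w Y y - y * \int[m]_(t in D) (Y t * w t)| <=
    y ^+ 2 * \int[m]_(t in D) (Y t ^+ 2 * w t).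
Proof.
move=> w0 mY iw iY iY2; have isn := integrable_sin y mY iw.
have iyY : m.-integrable D (EFin \o (fun t => y * (Y t * w t))).
  exact: (integrableZl mD y iY).
rewrite -RintegralZl// -RintegralB//; apply: (le_trans (le_normr_Rintegral mD _)).
  exact: (integrableB mD isn iyY).
rewrite -RintegralZl//; apply: le_Rintegral => //.
- exact: (integrable_norm (integrableB mD isn iyY)).
- exact: (integrableZl mD (y ^+ 2) iY2).
move=> t _; rewrite mulrA [y * Y t * _]mulrC -mulrBr normrM ger0_norm// [leLHS]mulrC mulrA.
rewrite ler_wpM2r// -exprMn; exact: sinB_le.
Qed.

Hypothesis mfin : (m D < +oo)%E.

Lemma integrable_one : m.-integrable D (EFin \o (fun=> 1)).
Proof. apply/integrableP; split; first exact: measurable_cst.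
by rewrite /= normr1 integral_cst// mul1e.
Qed.

Local Notation C Y := (cos_transform (fun=> 1) Y).
Local Notation S Y := (sin_transform (fun=> 1) Y).

Lemma integrable_of_abs Y : measurable_fun D Y ->
  (\int[m]_(t in D) `|Y t|%:E < +oo)%E -> m.-integrable D (EFin \o Y).
Proof. by move=> mY Yoo; apply/integrableP; split => //; exact/measurable_EFinP. Qed.

Lemma norm_sin_transform_le Y y : measurable_fun D Y ->
  m.-integrable D (EFin \o Y) ->
  `|S Y y| <= `|y| * \int[m]_(t in D) `|Y t|.
Proof.
move=> mY iY; have isn := integrable_sin y mY integrable_one.
apply: (le_trans (le_normr_Rintegral mD isn)).
have inY := integrable_norm iY.
rewrite -RintegralZl//; apply: le_Rintegral => //.
- exact: (integrable_norm isn).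
- exact: (integrableZl mD `|y| inY).
by move=> t _; rewrite mul1r -normrM norm_sin_le.
Qed.

Lemma is_derive_cos_transform Y : measurable_fun D Y ->
  m.-integrable D (EFin \o Y) -> is_derive (0 : R) (1 : R) (C Y) 0.
Proof.
move=> mY iY.
have e0 : \int[m]_(t in D) (- (Y t * sin (0 * Y t))) = 0.
  rewrite (@eq_Rintegral _ _ _ _ _ (fun=> 0)).
    by rewrite Rintegral_cst// mul0r.
  by move=> t _; rewrite mul0r sin0 mulr0 oppr0.
apply: (is_derive_eq _ e0).
apply: (@is_derive_under_integral _ _ _ m D (fun y t => 1 * cos (y * Y t))
  (fun y t => - (Y t * sin (y * Y t))) (fun t => `|Y t|) 0 1) => //.
- by move=> y _; apply: integrable_cos => //; exact: integrable_one.
- move=> y t _ _; under eq_fun do rewrite mul1r mulrC.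
  by rewrite [y * _]mulrC; exact: is_derive_cosZ.
- exact: integrable_norm.
- by move=> y t _ _; rewrite normrN normrM ler_piMr// sin_max.
Qed.

Lemma is_derive_sin_transform Y : measurable_fun D Y ->
  m.-integrable D (EFin \o Y) ->
  is_derive (0 : R) (1 : R) (S Y) (\int[m]_(t in D) Y t).
Proof.
move=> mY iY.
have -> : \int[m]_(t in D) Y t = \int[m]_(t in D) (Y t * cos (0 * Y t)).
  by apply: eq_Rintegral => t _; rewrite mul0r cos0 mulr1.
apply: (@is_derive_under_integral _ _ _ m D (fun y t => 1 * sin (y * Y t))
  (fun y t => Y t * cos (y * Y t)) (fun t => `|Y t|) 0 1) => //.
- by move=> y _; apply: integrable_sin => //; exact: integrable_one.
- move=> y t _ _; under eq_fun do rewrite mul1r mulrC.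
  by rewrite [y * _]mulrC; exact: is_derive_sinZ.
- exact: integrable_norm.
- by move=> y t _ _; rewrite normrM ler_piMr// cos_max.
Qed.

Lemma integrable_onem_cos Y y : measurable_fun D Y ->
  m.-integrable D (EFin \o (fun t => 1 - cos (y * Y t))).
Proof.
move=> mY; have := integrable_cos y mY integrable_one.
under [X in (EFin \o X)]eq_fun do rewrite mul1r.
by move=> ic; exact: (integrableB mD integrable_one ic).
Qed.

Lemma cos_transform_onem Y y : measurable_fun D Y ->
  C Y 0 - C Y y = \int[m]_(t in D) (1 - cos (y * Y t)).
Proof.
move=> mY; have ic := integrable_cos y mY integrable_one.
rewrite cos_transform0 -RintegralB//; last exact: integrable_one.
by apply: eq_Rintegral => t _; rewrite mul1r.
Qed.

Lemma integrable_dyadic_onem_cos Y e n : measurable_fun D Y ->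
  m.-integrable D (EFin \o (fun t => dyadic (fun y => 1 - cos y) (e * Y t) n)).
Proof.
move=> mY; elim: n e => [|n IH] e.
  rewrite (_ : (fun t => _) = cst 0).
    exact: integrable0.
  by apply/funext => t; rewrite /dyadic big_ord0.
have -> : (fun t => dyadic (fun y => 1 - cos y) (e * Y t) n.+1) =
    (fun t => (1 - cos (e * Y t)) + 2 * dyadic (fun y => 1 - cos y) (e / 2 * Y t) n).
  by apply/funext => t; rewrite dyadicS [e * _ / 2]mulrAC.
exact: (integrableD mD (integrable_onem_cos e mY) (integrableZl mD 2 (IH (e / 2)))).
Qed.

Lemma dyadic_cos_transform Y e n : measurable_fun D Y ->
  dyadic (fun y => C Y 0 - C Y y) e n =
  \int[m]_(t in D) dyadic (fun y => 1 - cos y) (e * Y t) n.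
Proof.
move=> mY; elim: n e => [|n IH] e.
  rewrite /dyadic big_ord0 (@eq_Rintegral _ _ _ _ _ (fun=> 0)).
    by rewrite Rintegral_cst// mul0r.
  by move=> t _; rewrite big_ord0.
have i1 := integrable_onem_cos e mY.
have i2 := integrable_dyadic_onem_cos (e / 2) n mY.
have i3 : m.-integrable D (EFin \o (fun t => 2 * dyadic (fun y => 1 - cos y) (e / 2 * Y t) n)).
  exact: (integrableZl mD 2 i2).
rewrite dyadicS IH cos_transform_onem// -RintegralZl// -RintegralD//.
by apply: eq_Rintegral => t _; rewrite dyadicS [e * _ / 2]mulrAC.
Qed.

Lemma dyadic_bounded_of_integrable Y e : measurable_fun D Y ->
  m.-integrable D (EFin \o Y) -> dyadic_bounded (fun y => C Y 0 - C Y y) e.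
Proof.
move=> mY iY; exists (6 * `|e| * \int[m]_(t in D) `|Y t|) => n.
have inY := integrable_norm iY.
rewrite dyadic_cos_transform// -RintegralZl//; apply: le_Rintegral => //.
- exact: integrable_dyadic_onem_cos.
- exact: (integrableZl mD (6 * `|e|) inY).
by move=> t _; rewrite -mulrA -normrM dyadic_onem_cos_le_norm.
Qed.

(** The infinite sum of 2^k (1 - cos (e Y / 2^k)) is integrable by monotone
    convergence, and dominates a multiple of |Y| where |e Y| >= 1/2. *)
Lemma integrable_of_dyadic_bounded Y (e : R) : 0 < e -> measurable_fun D Y ->
  dyadic_bounded (fun y => C Y 0 - C Y y) e -> m.-integrable D (EFin \o Y).
Proof.
move=> e0 mY [M hM].
pose c : R := 1 - cos (1 / 2).
have c0 : 0 < c := onem_cos_half_gt0.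
pose h k t : R := 2 ^+ k * (1 - cos (e * Y t / 2 ^+ k)).
have h0 k t : 0 <= h k t by rewrite mulr_ge0 ?exprn_ge0 ?onem_cos_ge0.
have mh k : measurable_fun D (h k).
  apply: measurable_funM => //; apply: measurable_funB => //.
  apply: (measurableT_comp (continuous_measurable_fun (@continuous_cos R))).
  by apply: measurable_funM => //; exact: measurable_funM.
have pt t : ((c * (e * `|Y t|))%:E <= c%:E + \sum_(k <oo) (h k t)%:E)%E.
  (* n halvings bring e |Y t| below 1. *)
  have [n nP] : exists n, e * `|Y t| < 2 ^+ n.
    exists (Num.truncn (e * `|Y t|)).+1; apply: lt_le_trans (truncnS_gt _) _.
    by rewrite -natrX ler_nat ltnW// ltn_expl.
  have hn : (dyadic (fun y => 1 - cos y) (e * Y t) n.+1)%:E =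
      (\sum_(0 <= k < n.+1) (h k t)%:E)%E.
    by rewrite sumEFin /dyadic big_mkord.
  have en : `|e * Y t| = e * `|Y t| by rewrite normrM gtr0_norm.
  have := @nneseries_lim_ge _ (fun k => (h k t)%:E) xpredT 0 n.+1.
  move=> /(_ _)/wrap[|H]; first by move=> k _ _; rewrite lee_fin.
  have [y1|y1] := leP (1 / 2) (e * `|Y t|).
    apply: (@le_trans _ _ (\sum_(k <oo) (h k t)%:E)%E); last first.
      by rewrite leeDr// lee_fin ltW.
    apply: le_trans H; rewrite -hn lee_fin -en dyadic_onem_cos_ge// en y1//.
  apply: (@le_trans _ _ c%:E).
    by rewrite lee_fin ler_piMr ?(ltW c0)//; lra.
  by rewrite leeDl// nneseries_ge0// => k _ _; rewrite lee_fin.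
have bnd : (\int[m]_(t in D) (c * (e * `|Y t|))%:E < +oo)%E.
  apply: (@le_lt_trans _ _ (\int[m]_(t in D) (c%:E + \sum_(k <oo) (h k t)%:E))%E).
    apply: ge0_le_integral => //.
    - by move=> t _; rewrite lee_fin !mulr_ge0// ltW.
    - apply/measurable_EFinP; apply: measurable_funM => //; apply: measurable_funM => //.
      exact: measurableT_comp.
    - apply: emeasurable_funD => //; apply: ge0_emeasurable_sum => //.
      + by move=> k t _ _; rewrite lee_fin.
      + by move=> k _; exact/measurable_EFinP.
  rewrite ge0_integralD//; first last.
  - apply: ge0_emeasurable_sum => //.
    + by move=> k t _ _; rewrite lee_fin.
    + by move=> k _; exact/measurable_EFinP.
  - by move=> t _; rewrite nneseries_ge0// => k _ _; rewrite lee_fin.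
  - by move=> t _; rewrite lee_fin ltW.
  apply: lte_add_pinfty.
    by rewrite integral_cst// lte_mul_pinfty// lee_fin ltW.
  rewrite integral_nneseries//; first last.
  - by move=> k t _; rewrite lee_fin.
  - by move=> k; exact/measurable_EFinP.
  apply: (@le_lt_trans _ _ M%:E); last by rewrite ltry.
  apply: lime_le.
    by apply: is_cvg_nneseries => k _ _; apply: integral_ge0 => t _; rewrite lee_fin.
  near=> n.
  rewrite -ge0_integral_sum//; first last.
  - by move=> k t _; rewrite lee_fin.
  - by move=> k; exact/measurable_EFinP.
  have -> : (\int[m]_(t in D) (\sum_(0 <= k < n) (h k t)%:E) =
    (dyadic (fun y => C Y 0 - C Y y) e n)%:E)%E.
    rewrite dyadic_cos_transform// /Rintegral fineK; last first.
      by apply: integrable_fin_num => //; exact: integrable_dyadic_onem_cos.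
    by apply: eq_integral => t _; rewrite sumEFin /dyadic big_mkord.
  by rewrite lee_fin.
have ce : (c * e)^-1 * (c * e) = 1 by rewrite mulVf// gt_eqF// mulr_gt0.
apply: integrable_of_abs => //.
have -> : (\int[m]_(t in D) `|Y t|%:E = \int[m]_(t in D) ((c * e)^-1%:E * (c * (e * `|Y t|))%:E))%E.
  by apply: eq_integral => t _; rewrite -EFinM (mulrA c e) (mulrA (c * e)^-1) ce mul1r.
rewrite ge0_integralZl//.
- by rewrite lte_mul_pinfty// lee_fin invr_ge0 mulr_ge0 ?ltW.
- apply/measurable_EFinP; apply: measurable_funM => //; apply: measurable_funM => //.
  exact: measurableT_comp.
- by move=> t _; rewrite lee_fin !mulr_ge0// ltW.
- by rewrite lee_fin invr_ge0 mulr_ge0 ?ltW.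
Unshelve. all: by end_near. Qed.

End moments.

(** * Second-order expansions at the origin *)

Section order_of_vanishing.
Context {R : realType}.
Implicit Types (f g : R -> R) (k l : nat) (F G : R -> R[i]).

(** The radius and the constant are explicit, because the estimate is used at
    all dyadic points below the radius at once. *)
Definition bigO_at0 k f := exists K e : R, [/\ 0 <= K, 0 < e, e <= 1 &
  forall y, `|y| <= e -> `|f y| <= K * `|y| ^+ k].

Lemma bigO_at0D k f g : bigO_at0 k f -> bigO_at0 k g -> bigO_at0 k (fun y => f y + g y).
Proof.
move=> [K [e [K0 e0 e1 fP]]] [L [e' [L0 e'0 e'1 gP]]].
exists (K + L), (Num.min e e'); split.
- exact: addr_ge0.
- by rewrite lt_min e0.
- by rewrite ge_min e1.
move=> y; rewrite le_min => /andP[y1 y2].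
by rewrite mulrDl (le_trans (ler_normD _ _))// lerD// ?fP ?gP.
Qed.

Lemma bigO_at0M k l f g : bigO_at0 k f -> bigO_at0 l g ->
  bigO_at0 (k + l) (fun y => f y * g y).
Proof.
move=> [K [e [K0 e0 e1 fP]]] [L [e' [L0 e'0 e'1 gP]]].
exists (K * L), (Num.min e e'); split.
- exact: mulr_ge0.
- by rewrite lt_min e0.
- by rewrite ge_min e1.
move=> y; rewrite le_min => /andP[y1 y2].
by rewrite normrM exprD mulrACA; apply: ler_pM; rewrite ?fP ?gP.
Qed.

Lemma bigO_at0W k l f : (k <= l)%N -> bigO_at0 l f -> bigO_at0 k f.
Proof.
move=> kl [K [e [K0 e0 e1 fP]]]; exists K, e; split=> // y ye.
apply: (le_trans (fP y ye)); rewrite ler_wpM2l//.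
by rewrite ler_wiXn2l// (le_trans ye).
Qed.

Lemma bigO_at0_cst (c : R) : bigO_at0 0 (fun=> c).
Proof. by exists `|c|, 1; split=> // y _; rewrite expr0 mulr1. Qed.

Lemma bigO_at0_id : bigO_at0 1 id.
Proof. by exists 1, 1; split=> // y _; rewrite expr1 mul1r. Qed.

Lemma bigO_at0Zl k c f : bigO_at0 k f -> bigO_at0 k (fun y => c * f y).
Proof. by move=> fk; rewrite -[k]add0n; apply: bigO_at0M (bigO_at0_cst c) fk. Qed.

Lemma bigO_at0N k f : bigO_at0 k f -> bigO_at0 k (fun y => - f y).
Proof.
by move=> [K [e [K0 e0 e1 fP]]]; exists K, e; split=> // y ye; rewrite normrN fP.
Qed.

Lemma eq_bigO_at0 k f g : f =1 g -> bigO_at0 k f -> bigO_at0 k g.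
Proof. by move=> /funext->. Qed.

Lemma near_eq_bigO_at0 k f g (e : R) : 0 < e ->
  (forall y, `|y| <= e -> f y = g y) -> bigO_at0 k f -> bigO_at0 k g.
Proof.
move=> e0 fg [K [e' [K0 e'0 e1 fP]]]; exists K, (Num.min e e'); split=> //.
- by rewrite lt_min e0.
- by rewrite ge_min e1 orbT.
by move=> y; rewrite le_min => /andP[y1 y2]; rewrite -fg ?fP.
Qed.

Lemma bigO_at0_half f (r : R) : 0 < r -> bigO_at0 1 (fun y => f y - r) ->
  exists e : R, [/\ 0 < e, e <= 1 & forall y, `|y| <= e -> r / 2 <= f y].
Proof.
move=> r0 [K [e [K0 e0 e1 fP]]].
have K1 : 0 < K + 1 by rewrite ltr_wpDl.
exists (Num.min e (r / (2 * (K + 1)))); split.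
- by rewrite lt_min e0/= divr_gt0// mulr_gt0.
- by rewrite ge_min e1.
move=> y; rewrite le_min => /andP[y1].
rewrite ler_pdivlMr ?mulr_gt0// => y2.
have h : `|f y - r| <= r / 2.
  apply: (le_trans (fP y y1)); rewrite expr1.
  apply: (@le_trans _ _ ((K + 1) * `|y|)).
    by rewrite ler_wpM2r// lerDl.
  lra.
by move: h; rewrite ler_norml => /andP[]; lra.
Qed.

Lemma bigO_at0V f (r : R) : 0 < r -> bigO_at0 1 (fun y => f y - r) ->
  bigO_at0 0 (fun y => (f y)^-1).
Proof.
move=> r0 /(bigO_at0_half r0)[e [e0 e1 fP]].
exists (2 / r), e; split => //; first by rewrite divr_ge0// ltW.
move=> y /fP f1; rewrite expr0 mulr1.
have f0 : 0 < f y by apply: lt_le_trans f1; rewrite divr_gt0.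
rewrite gtr0_norm ?invr_gt0// -[2 / r]invf_div lef_pV2 ?posrE//.
by rewrite divr_gt0.
Qed.

(** F y = r + i c y + O(y^2) as y tends to 0, with r and c real. *)
Definition expands F (r c : R) :=
  bigO_at0 2 (fun y => complex.Re (F y) - r) /\
  bigO_at0 2 (fun y => complex.Im (F y) - c * y).

Lemma expands_ReO0 F r c : expands F r c -> bigO_at0 0 (fun y => complex.Re (F y)).
Proof.
move=> [h _]; apply: (@eq_bigO_at0 _ (fun y => complex.Re (F y) - r + r)).
  by move=> y; rewrite subrK.
by apply: bigO_at0D (bigO_at0_cst r); exact: (@bigO_at0W 0 2).
Qed.

Lemma expands_ImO1 F r c : expands F r c -> bigO_at0 1 (fun y => complex.Im (F y)).
Proof.
move=> [_ h]; apply: (@eq_bigO_at0 _ (fun y => complex.Im (F y) - c * y + c * y)).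
  by move=> y; rewrite subrK.
apply: bigO_at0D; first exact: (@bigO_at0W 1 2).
exact: (bigO_at0Zl c bigO_at0_id).
Qed.

Lemma ReM (z w : R[i]) : complex.Re (z * w) =
  complex.Re z * complex.Re w - complex.Im z * complex.Im w.
Proof. by case: z; case: w. Qed.

Lemma ImM (z w : R[i]) : complex.Im (z * w) =
  complex.Re z * complex.Im w + complex.Im z * complex.Re w.
Proof. by case: z; case: w. Qed.

Lemma ReV (z : R[i]) : complex.Re z^-1 =
  complex.Re z / (complex.Re z ^+ 2 + complex.Im z ^+ 2).
Proof. by case: z. Qed.

Lemma ImV (z : R[i]) : complex.Im z^-1 =
  - (complex.Im z / (complex.Re z ^+ 2 + complex.Im z ^+ 2)).
Proof. by case: z. Qed.

Lemma expandsM F G r c s d : expands F r c -> expands G s d ->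
  expands (fun y => F y * G y) (r * s) (r * d + c * s).
Proof.
move=> eF eG; have [F1 F2] := eF; have [G1 G2] := eG.
have G0 := expands_ReO0 eG; have Fi := expands_ImO1 eF; have Gi := expands_ImO1 eG.
split.
  apply: (@eq_bigO_at0 _ (fun y => ((complex.Re (F y) - r) * complex.Re (G y) +
      r * (complex.Re (G y) - s)) + - (complex.Im (F y) * complex.Im (G y)))).
    by move=> y; rewrite ReM; ring.
  apply: bigO_at0D; last by apply: bigO_at0N; exact: (@bigO_at0M 1 1).
  by apply: bigO_at0D; [exact: (@bigO_at0M 2 0)|exact: bigO_at0Zl].
apply: (@eq_bigO_at0 _ (fun y => (((complex.Re (F y) - r) * complex.Im (G y) +
      r * (complex.Im (G y) - d * y)) + (complex.Im (F y) - c * y) * complex.Re (G y)) +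
      c * y * (complex.Re (G y) - s))).
  by move=> y; rewrite ImM; ring.
apply: bigO_at0D.
  apply: bigO_at0D; last exact: (@bigO_at0M 2 0).
  apply: bigO_at0D; last exact: bigO_at0Zl.
  by apply: (@bigO_at0W 2 3) => //; exact: (@bigO_at0M 2 1).
apply: (@bigO_at0W 2 3) => //; apply: (@bigO_at0M 1 2) => //.
exact: (bigO_at0Zl c bigO_at0_id).
Qed.

Lemma expandsV F r c : 0 < r -> expands F r c ->
  expands (fun y => (F y)^-1) r^-1 (- (c / r ^+ 2)).
Proof.
move=> r0 eF; have [F1 F2] := eF.
have F0 := expands_ReO0 eF; have Fi := expands_ImO1 eF.
pose N y := complex.Re (F y) ^+ 2 + complex.Im (F y) ^+ 2.
have Nr : bigO_at0 2 (fun y => N y - r ^+ 2).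
  apply: (@eq_bigO_at0 _ (fun y => (complex.Re (F y) - r) * (complex.Re (F y) + r) +
      complex.Im (F y) * complex.Im (F y))).
    by move=> y; rewrite /N; ring.
  apply: bigO_at0D; last exact: (@bigO_at0M 1 1).
  apply: (@bigO_at0M 2 0) => //; apply: bigO_at0D => //; exact: bigO_at0_cst.
have r2 : 0 < r ^+ 2 by rewrite exprn_gt0.
have NV : bigO_at0 0 (fun y => (N y)^-1).
  by apply: (bigO_at0V r2); exact: (@bigO_at0W 1 2).
have [e [e0 _ Ne]] := bigO_at0_half r2 (@bigO_at0W 1 2 _ isT Nr).
have N0 y : `|y| <= e -> N y != 0.
  by move=> /Ne N0; rewrite gt_eqF// (lt_le_trans _ N0)// divr_gt0.
split.
  apply: (@near_eq_bigO_at0 _ (fun y => - r^-1 * ((complex.Re (F y) - r) *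
      complex.Re (F y) + complex.Im (F y) * complex.Im (F y)) * (N y)^-1) _ e e0).
    move=> y /N0; rewrite ReV /N => Ny.
    by field; rewrite gt_eqF.
  apply: (@bigO_at0M 2 0) => //; apply: bigO_at0Zl; apply: bigO_at0D.
    exact: (@bigO_at0M 2 0).
  exact: (@bigO_at0M 1 1).
apply: (@near_eq_bigO_at0 _ (fun y => (- (complex.Im (F y) - c * y) +
    c / r ^+ 2 * y * (N y - r ^+ 2)) * (N y)^-1) _ e e0).
  move=> y /N0; rewrite ImV /N => Ny.
  by field; rewrite gt_eqF.
apply: (@bigO_at0M 2 0) => //; apply: bigO_at0D; first exact: bigO_at0N.
apply: (@bigO_at0W 2 3) => //; apply: (@bigO_at0M 1 2) => //.
exact: (bigO_at0Zl _ bigO_at0_id).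
Qed.

Lemma bigO_at0_is_derive f (a c : R) : bigO_at0 2 (fun y => f y - a - c * y) ->
  is_derive (0 : R) (1 : R) f c.
Proof.
move=> [K [e [K0 e0 e1 fP]]].
have f0 : f 0 = a.
  have := fP 0; rewrite normr0 expr0n/= !mulr0 subr0 normr_le0 subr_eq0.
  by move=> /(_ (ltW e0))/eqP.
have cv : h^-1 *: (f (h *: 1 + 0) - f 0) @[h --> (0 : R)^'] --> c.
  apply/cvgrPdist_le => eps eps0; near=> h.
  have h0 : h != 0 by near: h; exact: nbhs_dnbhs_neq.
  have he : `|h| <= Num.min e (eps / (K + 1)).
    near: h; apply: dnbhs0_le; rewrite lt_min e0/= divr_gt0// ltr_wpDl//.
  move: he; rewrite le_min => /andP[h1 h2].
  have := fP _ h1; rewrite /GRing.scale/= mulr1 addr0 f0 => hK.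
  have -> : c - h^-1 * (f h - a) = - (h^-1 * (f h - a - c * h)) by field.
  rewrite normrN normrM normfV ler_pdivrMl ?normr_gt0//.
  apply: (le_trans hK); rewrite expr2 mulrA [leRHS]mulrC ler_wpM2r//.
  move: h2; rewrite ler_pdivlMr ?ltr_wpDl// => h2.
  by apply: le_trans h2; rewrite mulrC ler_wpM2l// lerDl.
apply: DeriveDef.
  by apply/cvg_ex; exists c.
by apply: cvg_lim => //.
Unshelve. all: by end_near. Qed.

End order_of_vanishing.

(** * The quotient of Gamma functions near the origin *)

Section complex_gamma.
Context {R : realType}.
Implicit Types (x y : R).
Local Notation mu := (@lebesgue_measure R).
Local Notation halfline := (`]0%R, +oo[%classic : set R).

Let weight x (t : R) : R := t `^ (x - 1) * expR (- t).

Let weight_ge0 x t : 0 <= weight x t.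
Proof. by rewrite mulr_ge0 ?powR_ge0 ?expR_ge0. Qed.

(** Since t^(x - 1 + i y) = t^(x - 1) e^(i y ln t), the complex Gamma integral is a
    Fourier transform in y of the real integrand seen through ln. *)
Lemma cGammaE x y : cGamma (x +i* y) =
  cos_transform mu halfline (weight x) (@ln R) y +i*
  sin_transform mu halfline (weight x) (@ln R) y.
Proof.
rewrite /cGamma /cintegral; congr (_ +i* _); apply: eq_Rintegral => t /halflineP t0.
  rewrite /weight /cexp /powR (gt_eqF t0) ReM ImM/=.
  by rewrite !mulr0 !mul0r !subr0 !add0r ?addr0 mulrAC.
rewrite /weight /cexp /powR (gt_eqF t0) ReM ImM/=.
by rewrite !mulr0 !mul0r ?subr0 ?add0r ?addr0 mulrAC.
Qed.

(** The real integrand has finite moments in ln t of orders one and two, which is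
    all that a second-order expansion of its Fourier transform requires. *)
Lemma expands_cGamma x : 0 < x -> expands (fun y => cGamma (x +i* y)) (Gamma x) (dGamma x).
Proof.
move=> x0.
have k0 : 0 < x / 2 by rewrite divr_gt0.
have mD : measurable halfline by [].
have mw : measurable_fun [set: R] (fun t : R => expR (- t)) by exact: measurableT_comp.
have mW : measurable_fun [set: R] (weight x).
  by apply: measurable_funM => //; exact: measurable_powR.
have ml : measurable_fun halfline (@ln R) by apply: measurable_funTS; exact: measurable_ln.
have im : mellin_integrable (fun t : R => expR (- t)) (x - 1 - x / 2).
  by rewrite addrAC [x - x / 2](_ : _ = x / 2); [exact: Gamma_mellin_integrable|field].
have ip : mellin_integrable (fun t : R => expR (- t)) (x - 1 + x / 2).
  by rewrite addrAC; apply: Gamma_mellin_integrable; rewrite addr_gt0.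
have iw : mu.-integrable halfline (EFin \o weight x).
  exact: (Gamma_mellin_integrable x0).
have e0 t : 0 <= expR (- t) :> R by exact: expR_ge0.
have bnd (u : R) : x / 2 * `|ln u| <= expR (x / 2 * `|ln u|).
  by apply: le_trans (expR_ge1Dx _); rewrite lerDr.
have bnd2 (u : R) : ln u ^+ 2 <= 4 / (x / 2) ^+ 2 * expR (x / 2 * `|ln u|).
  rewrite -[ln u ^+ 2]real_normK ?num_real// mulrAC ler_pdivlMr ?exprn_gt0//.
  have := expR_ge1Dx (x / 2 * `|ln u| / 2).
  have h : 0 <= x / 2 * `|ln u| / 2 by rewrite divr_ge0// mulr_ge0// ltW.
  move=> h1; have h2 : x / 2 * `|ln u| / 2 <= expR (x / 2 * `|ln u| / 2).
    by apply: le_trans h1; rewrite lerDr.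
  rewrite (_ : expR (x / 2 * `|ln u|) = expR (x / 2 * `|ln u| / 2) ^+ 2); last first.
    by rewrite expr2 -expRD; congr expR; field.
  rewrite (_ : `|ln u| ^+ 2 * (x / 2) ^+ 2 = 4 * (x / 2 * `|ln u| / 2) ^+ 2); last by field.
  by rewrite ler_wpM2l// lerXn2r// nnegrE// expR_ge0.
have iY : mu.-integrable halfline (EFin \o (fun t => ln t * weight x t)).
  apply: (le_mellin_integrable im ip (c := (x / 2)^-1)) => //.
  - by apply: measurable_funM => //; exact: measurable_ln.
  - by rewrite invr_ge0 ltW.
  move=> u u0; rewrite normrM (ger0_norm (weight_ge0 _ _)) ler_pdivlMl//.
  by rewrite mulrA /weight mulrA ler_wpM2r// mulrC ler_wpM2l ?powR_ge0.
have iY2 : mu.-integrable halfline (EFin \o (fun t => ln t ^+ 2 * weight x t)).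
  apply: (le_mellin_integrable im ip (c := 4 / (x / 2) ^+ 2)) => //.
  - apply: measurable_funM => //; apply: measurable_funX; exact: measurable_ln.
  - by rewrite divr_ge0// sqr_ge0.
  move=> u u0; rewrite normrM (ger0_norm (weight_ge0 _ _)) ger0_norm ?sqr_ge0//.
  have -> : 4 / (x / 2) ^+ 2 * (u `^ (x - 1) * expR (x / 2 * `|ln u|) * expR (- u)) =
      4 / (x / 2) ^+ 2 * expR (x / 2 * `|ln u|) * weight x u.
    by rewrite /weight; ring.
  by rewrite ler_wpM2r.
pose M := \int[mu]_(t in halfline) (ln t ^+ 2 * weight x t).
have M0 : 0 <= M by apply: Rintegral_ge0 => t _; rewrite mulr_ge0 ?sqr_ge0.
split; exists M, 1; split=> // y _; rewrite cGammaE/= real_normK ?num_real// [M * _]mulrC.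
  exact: (@cos_transform_expansion _ _ _ mu halfline mD (weight x) (@ln R) y (weight_ge0 x) ml iw iY2).
rewrite [dGamma x * _]mulrC.
exact: (@sin_transform_expansion _ _ _ mu halfline mD (weight x) (@ln R) y (weight_ge0 x) ml iw iY iY2).
Qed.

#[local] Opaque Gamma dGamma.

Lemma bigO_at0_comp_opp k (f : R -> R) : bigO_at0 k f -> bigO_at0 k (fun y => f (- y)).
Proof.
move=> [K [e [K0 e0 e1 fP]]]; exists K, e; split=> // y ye.
by have := fP (- y); rewrite normrN => ->.
Qed.

Lemma expands_opp (F : R -> R[i]) (r c : R) : expands F r c ->
  expands (fun y => F (- y)) r (- c).
Proof.
move=> [F1 F2]; split; first exact: (bigO_at0_comp_opp F1).
apply: eq_bigO_at0 (bigO_at0_comp_opp F2) => y.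
by rewrite mulrN mulNr.
Qed.

(** The first-order coefficient is a combination of four logarithmic derivatives
    of Gamma; those at a and 1 - a combine into a cotangent. *)
Lemma expands_Gamma_ratio (alpha a : R) : 0 < alpha -> 0 < a < 1 ->
  expands (fun y => cGamma (alpha -i* y) / cGamma (a -i* y) *
    (cGamma (1 +i* y) / cGamma ((1 - a) +i* y)))
  (Gamma alpha / (Gamma a * Gamma (1 - a)))
  (Gamma alpha / (Gamma a * Gamma (1 - a)) *
    (dGamma 1 - dGamma alpha / Gamma alpha - pi * cot (pi * a))).
Proof.
move=> al0 a01; have /andP[a0 a1] := a01.
have b0 : 0 < 1 - a by rewrite subr_gt0.
have e1 := expands_opp (expands_cGamma al0).
have e2 := expandsV (Gamma_gt0 a0) (expands_opp (expands_cGamma a0)).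
have e3 := expands_cGamma (@ltr01 R).
have e4 := expandsV (Gamma_gt0 b0) (expands_cGamma b0).
have := expandsM (expandsM e1 e2) (expandsM e3 e4).
rewrite -(dGamma_reflection a01) Gamma1.
have gA := Gamma_gt0 al0; have ga := Gamma_gt0 a0; have gb := Gamma_gt0 b0.
move: (Gamma alpha) (Gamma a) (Gamma (1 - a)) (dGamma alpha) (dGamma a) (dGamma (1 - a)) (dGamma 1) gA ga gb {e1 e2 e3 e4} => A g h dA dg dh d1 A0 g0 h0.
by congr (expands _ _ _); field; rewrite ?(gt_eqF A0) ?(gt_eqF g0) ?(gt_eqF h0).
Qed.

End complex_gamma.

(** * The constants of the process *)

Section constants.
Context {R : realType}.
Implicit Types (alpha rho a : R).

Lemma permissible_bounds alpha rho : permissible alpha rho ->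
  0 < alpha /\ 0 < alpha * rho_hat rho < 1.
Proof.
rewrite /rho_hat => -[[/andP[a0 a1] /andP[r0 r1]]|[/andP[a1 _] /andP[r1 r2]]|[-> ->]].
- split=> //; rewrite mulr_gt0 ?subr_gt0//=.
  by rewrite (@lt_trans _ _ alpha)// gtr_pMr// gtrBl.
- have a0 : 0 < alpha by exact: lt_trans a1.
  have i1 : alpha^-1 < 1 by rewrite invf_lt1.
  split=> //; rewrite mulr_gt0 ?subr_gt0//=; last exact: lt_trans i1.
  by rewrite mulrC -ltr_pdivlMr// mul1r ltrBlDl -ltrBlDr.
- by split; lra.
Qed.

Lemma c_minus_gt0 alpha rho : 0 < alpha -> 0 < alpha * rho_hat rho < 1 ->
  0 < c_minus alpha rho.
Proof.
move=> a0 /andP[b0 b1]; rewrite /c_minus divr_gt0 ?mulr_gt0 ?Gamma_gt0//.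
- by rewrite addr_gt0.
- by rewrite subr_gt0.
Qed.

(** The mass of the resurrection measure is the value at 0 of the quotient of
    Gamma functions. *)
Lemma c_minus_div alpha rho : 0 < alpha -> c_minus alpha rho / alpha =
  Gamma alpha / (Gamma (alpha * rho_hat rho) * Gamma (1 - alpha * rho_hat rho)).
Proof.
move=> a0; rewrite /c_minus GammaD1// mulrC 2!mulrA mulVf ?gt_eqF//.
by rewrite mul1r.
Qed.

Lemma Gamma_ratio_sin alpha a : 0 < a < 1 ->
  Gamma alpha / (Gamma a * Gamma (1 - a)) = Gamma alpha * (sin (pi * a) / pi).
Proof.
move=> a01; have /andP[a0 a1] := a01; congr (_ * _).
rewrite -[X in _ = _ / X](Gamma_reflection a01) [in RHS]invfM mulrCA divff ?mulr1//.
by rewrite gt_eqF// sin_pi_gt0.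
Qed.

End constants.

(** * Integration against the resurrection kernel *)

Section resurrection_integral.
Context {R : realType}.
Variables (phi : probability (measurableTypeR R) R) (alpha rho : R).
Local Notation mu := (@lebesgue_measure R).
Local Notation halfline := (`]0%R, +oo[%classic : set R).
Local Notation neghalfline := (`]-oo, 0%R[%classic : set R).
Local Notation q := (resurrection_kernel phi alpha rho 1).

Let dens (z : R) : R := c_minus alpha rho * (1 - z) `^ (- 1 - alpha).

Let dens_ge0 z : 0 <= dens z.
Proof. by rewrite mulr_ge0 ?powR_ge0// divr_ge0 ?mulr_ge0 ?Gamma_ge0. Qed.

Let mdens : measurable_fun [set: R] dens.
Proof.
apply: measurable_funM; first exact: measurable_cst.
apply: (measurableT_comp (measurable_powR _)).
by apply: measurable_funB; [exact: measurable_cst|exact: measurable_id].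
Qed.

(** The integral of f against the return kernel p(z, .), the image of phi under
    multiplication by |z|. *)
Definition dilation_integral (f : R -> \bar R) (z : R) : \bar R :=
  (\int[phi]_w f (`|z| * w)%R)%E.

Lemma measurable_dilation (f : R -> \bar R) : measurable_fun [set: R] f ->
  measurable_fun [set: R * R] (fun zw : R * R => f (`|zw.1| * zw.2)%R).
Proof.
move=> mf; apply: (measurableT_comp mf).
apply: measurable_funM; last exact: measurable_snd.
by apply: measurableT_comp => //; exact: measurable_fst.
Qed.

Lemma measurable_dilationr (f : R -> \bar R) (z : R) : measurable_fun [set: R] f ->
  measurable_fun [set: R] (fun w : R => f (`|z| * w)%R).
Proof. by move=> mf; apply: (measurableT_comp mf); exact: mulrl_measurable. Qed.

Lemma measurable_dilation_integral (f : R -> \bar R) : measurable_fun [set: R] f ->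
  (forall y, 0 <= f y)%E -> measurable_fun [set: R] (dilation_integral f).
Proof.
move=> mf f0.
exact: (@measurable_fun_fubini_tonelli_F _ _ (measurableTypeR R) (measurableTypeR R) R phi
  (fun zw : R * R => f (`|zw.1| * zw.2)%R) (measurable_dilation mf) (fun=> f0 _)).
Qed.

Lemma dilation_integral_ge0 (f : R -> \bar R) z : (forall y, 0 <= f y)%E ->
  (0 <= dilation_integral f z)%E.
Proof. by move=> f0; apply: integral_ge0 => w _. Qed.

Definition resurrection_integral (f : R -> \bar R) : \bar R :=
  (\int[mu]_(z in neghalfline) ((dens z)%:E * dilation_integral f z))%E.

Let mterm (f : R -> \bar R) : measurable_fun [set: R] f -> (forall y, 0 <= f y)%E ->
  measurable_fun neghalfline (fun z => (dens z)%:E * dilation_integral f z)%E.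
Proof.
move=> mf f0; apply: measurable_funTS; apply: emeasurable_funM.
  exact/measurable_EFinP.
exact: measurable_dilation_integral.
Qed.

Let term_ge0 (f : R -> \bar R) z : (forall y, 0 <= f y)%E ->
  (0 <= (dens z)%:E * dilation_integral f z)%E.
Proof. by move=> f0; rewrite mule_ge0 ?lee_fin// dilation_integral_ge0. Qed.

(** The definition of the kernel, once the direct image |z|^-1 A is read as a
    preimage under w |-> |z| w. *)
Lemma resurrection_integral_indic (A : set R) : measurable A ->
  q A = resurrection_integral (fun y => (\1_A y)%:E).
Proof.
move=> mA; apply: eq_integral => z /[!inE]; rewrite /= in_itv/= => z0.
congr (_ * _)%E; rewrite /dilation_integral.
have nz : `|z| != 0 by rewrite normr_eq0 lt_eqF.
pose h (w : R) : R := `|(z : R)| * w.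
have -> : (\int[phi]_w (\1_A (h w))%:E = phi (h @^-1` A))%E.
  rewrite -(setIT (h @^-1` A)) -[RHS]integral_indic//.
  rewrite -[X in measurable X]setTI; exact: (mulrl_measurable `|(z : R)|).
congr (phi _); apply/seteqP; split => [_ [a Aa <-]|w /= Aw].
  by rewrite /= /h mulrA divff// mul1r.
by exists (`|(z : R)| * w) => //; rewrite mulrA mulVf// mul1r.
Qed.

Import HBNNSimple.

Lemma measurable_level (g : {nnsfun (measurableTypeR R) >-> R}) (k : R) :
  measurable (g @^-1` [set k]).
Proof. by []. Qed.

Lemma measurable_indic_level (g : {nnsfun (measurableTypeR R) >-> R}) (k : R) :
  measurable_fun [set: R] (\1_(g @^-1` [set k]) : R -> R).
Proof. apply: measurable_indic; exact: (measurable_level g k). Qed.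

Lemma measurable_scaled_indic (g : {nnsfun (measurableTypeR R) >-> R}) (k : R) :
  measurable_fun [set: R] (fun y : R => (k * \1_(g @^-1` [set k]) y)%:E).
Proof. by apply/measurable_EFinP/measurable_funM => //; exact: measurable_indic_level. Qed.

Lemma dilation_integral_nnsfun (g : {nnsfun (measurableTypeR R) >-> R}) z :
  dilation_integral (fun y => (g y)%:E) z =
  (\sum_(k \in range g) dilation_integral (fun y => (k * \1_(g @^-1` [set k]) y)%:E) z)%E.
Proof.
rewrite /dilation_integral.
under eq_integral do rewrite fimfunE -fsumEFin//.
rewrite ge0_integral_fsum//.
  by move=> k; exact: (measurable_dilationr z (measurable_scaled_indic g k)).
by move=> k w _; rewrite nnfun_muleindic_ge0.
Qed.

Lemma resurrection_integral_nnsfun (g : {nnsfun (measurableTypeR R) >-> R}) :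
  (\int[q]_y (g y)%:E)%E = resurrection_integral (fun y => (g y)%:E).
Proof.
under eq_integral do rewrite fimfunE -fsumEFin//.
rewrite ge0_integral_fsum//; first last.
- by move=> k y _; rewrite nnfun_muleindic_ge0.
- by move=> k; exact: measurable_scaled_indic.
have i0 (k y : R) : (0 <= (\1_(g @^-1` [set k]) y)%:E :> \bar R)%E by rewrite lee_fin.
have mi (k : R) : measurable_fun [set: R] (fun y : R => (\1_(g @^-1` [set k]) y)%:E : \bar R).
  by apply/measurable_EFinP; exact: measurable_indic_level.
have ki0 (k y : R) : (0 <= (k * \1_(g @^-1` [set k]) y)%:E :> \bar R)%E.
  exact: nnfun_muleindic_ge0.
transitivity (\sum_(k \in range g) resurrection_integral
    (fun y => (k * \1_(g @^-1` [set k]) y)%:E))%E.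
  apply: eq_fsbigr => k; rewrite inE => -[y _ <-]; set r := g y.
  rewrite integralZl_indic_nnsfun// integral_indic// setIT.
  have r0 : 0 <= r by exact: fun_ge0.
  transitivity (r%:E * resurrection_integral (fun y => (\1_(g @^-1` [set r]) y)%:E))%E.
    congr (_ * _)%E; exact: (resurrection_integral_indic (measurable_level g r)).
  rewrite /resurrection_integral -ge0_integralZl//; [|exact: mterm|by move=> z _; exact: term_ge0].
  apply: eq_integral => z _; rewrite muleCA; congr (_ * _)%E.
  rewrite /dilation_integral -ge0_integralZl//.
  exact: (measurable_dilationr z (mi r)).
rewrite /resurrection_integral -ge0_integral_fsum//.
- apply: eq_integral => z _.
  rewrite dilation_integral_nnsfun ge0_mule_fsumr//.
  by move=> k; exact: dilation_integral_ge0.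
- by move=> k; apply: mterm => //; exact: measurable_scaled_indic.
- by move=> k z _; exact: term_ge0.
Qed.

(** From indicators to nonnegative functions by simple functions and monotone
    convergence, applied three times: for the kernel, for phi and for the outer
    integral. *)
Lemma resurrection_integralE (f : R -> \bar R) : measurable_fun [set: R] f ->
  (forall y, 0 <= f y)%E -> (\int[q]_y f y)%E = resurrection_integral f.
Proof.
move=> mf f0.
pose g := nnsfun_approx (@measurableT _ (measurableTypeR R)) mf.
have mg n : measurable_fun [set: R] (fun y : R => (g n y)%:E).
  apply/measurable_EFinP; exact: (measurable_funP (g n)).
have g0 n y : (0 <= (g n y)%:E)%E by rewrite lee_fin.
have nd y : {homo (fun n => (g n y)%:E) : n m / (n <= m)%N >-> (n <= m)%E}.
  by move=> n k nk; rewrite lee_fin; exact/lefP/nd_nnsfun_approx.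
have gf y : limn (fun n => (g n y)%:E) = f y.
  by apply/cvg_lim => //; exact: cvg_nnsfun_approx.
transitivity (limn (fun n => \int[q]_y (g n y)%:E)%E).
  rewrite -monotone_convergence//.
  by apply: eq_integral => y _; rewrite gf.
under eq_fun do rewrite resurrection_integral_nnsfun.
have ndd z : {homo (fun n => dilation_integral (fun y => (g n y)%:E) z) : n m / (n <= m)%N >-> (n <= m)%E}.
  move=> n k nk; apply: ge0_le_integral => //.
  - exact: (measurable_dilationr z (mg n)).
  - exact: (measurable_dilationr z (mg k)).
  - by move=> w _; exact: nd.
have gz n z : (0 <= dilation_integral (fun y => (g n y)%:E) z)%E.
  exact: dilation_integral_ge0.
rewrite -monotone_convergence//; first last.
- by move=> z _ n k nk; apply: lee_wpmul2l; [rewrite lee_fin|exact: ndd].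
- by move=> n z _; exact: term_ge0.
- by move=> n; exact: mterm.
apply: eq_integral => z _.
rewrite limeMl//; last by apply: ereal_nondecreasing_is_cvgn; exact: ndd.
congr (_ * _)%E; rewrite /dilation_integral -monotone_convergence//.
- by apply: eq_integral => w _; rewrite gf.
by move=> n; exact: (measurable_dilationr z (mg n)).
Qed.

Definition jump_density (u : R) : R := c_minus alpha rho * (1 + u) `^ (- (1 + alpha)).

Lemma jump_density_ge0 u : 0 <= jump_density u.
Proof. by rewrite mulr_ge0 ?powR_ge0// divr_ge0 ?mulr_ge0 ?Gamma_ge0. Qed.

Lemma measurable_jump_density : measurable_fun [set: R] jump_density.
Proof.
apply: measurable_funM; first exact: measurable_cst.
apply: (measurableT_comp (measurable_powR _)).
by apply: measurable_funD; [exact: measurable_cst|exact: measurable_id].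
Qed.

(** The substitution u = - z displays the kernel as the image of a product measure
    on the quarter plane under multiplication. *)
Lemma resurrection_integral_halfline (f : R -> \bar R) : measurable_fun [set: R] f ->
  (forall y, 0 <= f y)%E ->
  (\int[q]_(y in halfline) f y = \int[mu]_(u in halfline)
     ((jump_density u)%:E * \int[phi]_(w in halfline) f (u * w)%R))%E.
Proof.
move=> mf f0.
have mh : measurable (halfline : set (measurableTypeR R)) by [].
pose g := f \_ halfline.
have mg : measurable_fun [set: R] g.
  apply/(measurable_restrictT f (_ : measurable halfline)) => //.
  exact: measurable_funTS.
have g0 y : (0 <= g y)%E by rewrite /g patchE; case: ifP.
rewrite integral_mkcond (resurrection_integralE mg g0) /resurrection_integral.
pose h z := ((dens (- z))%:E * dilation_integral g z)%E.
have mh' : measurable_fun [set: R] h.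
  apply: emeasurable_funM; last exact: measurable_dilation_integral.
  by apply/measurable_EFinP; apply: measurableT_comp.
have h0 z : (0 <= h z)%E.
  by rewrite mule_ge0 ?lee_fin// dilation_integral_ge0.
rewrite -[RHS](_ : (\int[mu]_(u in halfline) h u = _)%E); last first.
  apply: eq_integral => u /halflineP u0; congr (_ * _)%E.
    by rewrite /dens /jump_density opprK opprD.
  rewrite /dilation_integral [RHS]integral_mkcond.
  apply: eq_integral => w _; rewrite /g !patchE gtr0_norm//.
  congr (if _ then _ else _).
  by apply/idP/idP; rewrite !inE /= !in_itv/= !andbT; rewrite pmulr_rgt0.
rewrite [RHS]integral_itv_obnd_cbnd; last exact: measurable_funTS.
rewrite (ge0_integration_by_substitution0 mh' h0).
rewrite -[RHS]integral_itv_bndo_bndc; last first.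
  by apply: measurable_funTS; apply: measurableT_comp.
apply: eq_integral => z _; rewrite /h opprK; congr (_ * _)%E.
by apply: eq_integral => w _; rewrite normrN.
Qed.

End resurrection_integral.

#[local] Opaque c_minus.

Lemma small_exponent (R : realType) (a : R) : 0 < a ->
  exists e : R, [/\ 0 < e, e < a & e < 1].
Proof.
by move=> a0; case: (leP a 1) => a1; [exists (a / 4)|exists (1 / 4)]; split; lra.
Qed.

Lemma measurable_dilation_section (R : realType) (phi : probability (measurableTypeR R) R)
    (f : R -> \bar R) : measurable_fun [set: R] f -> (forall y, 0 <= f y)%E ->
  measurable_fun [set: R] (fun u : R => \int[phi]_(w in `]0%R, +oo[) f (u * w)%R)%E.
Proof.
move=> mf f0.
pose D : set (R * R) := [set: R] `*` `]0%R, +oo[.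
pose F := (fun uw : R * R => f (uw.1 * uw.2)%R) \_ D.
have mF : measurable_fun [set: R * R] F.
  apply/(measurable_restrictT _ (_ : measurable D)).
    by apply: measurableX.
  apply: measurable_funTS; apply: (measurableT_comp mf).
  by apply: measurable_funM; [exact: measurable_fst|exact: measurable_snd].
have F0 z : (0 <= F z)%E by rewrite /F patchE; case: ifP.
have := @measurable_fun_fubini_tonelli_F _ _ (measurableTypeR R) (measurableTypeR R) R phi
  F mF F0.
congr (measurable_fun _ _); apply/funext => u.
rewrite /fubini_F [RHS]integral_mkcond; apply: eq_integral => w _.
rewrite /F !patchE; congr (if _ then _ else _).
by apply/idP/idP; rewrite !inE /D/= => // -[].
Qed.

(** * The logarithm under the resurrection kernel *)

Section log_moment.
Context {R : realType}.
Variables (phi : probability (measurableTypeR R) R) (alpha rho : R).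
Local Notation mu := (@lebesgue_measure R).
Local Notation halfline := (`]0%R, +oo[%classic : set R).
Local Notation q := (resurrection_kernel phi alpha rho 1).
Local Notation k := (jump_density alpha rho).
Hypothesis (alpha0 : 0 < alpha) (c0 : 0 < c_minus alpha rho).
Hypothesis phi1 : phi halfline = 1%E.

Let mD : measurable halfline. Proof. by []. Qed.

Let mDR : measurable (halfline : set (measurableTypeR R)). Proof. by []. Qed.

Let mk : measurable_fun [set: R] k. Proof. exact: measurable_jump_density. Qed.

Let k0 u : 0 <= k u. Proof. exact: jump_density_ge0. Qed.

Lemma integral_jump_density :
  (\int[mu]_(u in halfline) (k u)%:E = (c_minus alpha rho / alpha)%:E)%E.
Proof.
have mp : measurable_fun [set: R] (fun u : R => (1 + u) `^ (- (1 + alpha))).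
  apply: (measurableT_comp (measurable_powR _)).
  by apply: measurable_funD; [exact: measurable_cst|exact: measurable_id].
have p0 (u : R) : 0 <= (1 + u) `^ (- (1 + alpha)) by exact: powR_ge0.
rewrite (ge0_integralZlR mu mD (ltW c0) p0 mp).
rewrite (EFinM _ alpha^-1) -(integral_onem_powR alpha0); congr (_ * _)%E.
by apply: eq_integral => t _; rewrite subrr powRr0 mul1r.
Qed.

Lemma integrable_jump_density : mu.-integrable halfline (EFin \o k).
Proof.
apply/integrableP; split; first by apply: measurable_funTS; exact/measurable_EFinP.
under eq_integral do rewrite /= ger0_norm//.
by rewrite integral_jump_density ltry.
Qed.

(** Both u^e and u^(- e) are integrable against the density for small e > 0, and
    together they dominate |ln u|. *)
Lemma integrable_jump_density_ln : mu.-integrable halfline (EFin \o (fun u => k u * ln u)).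
Proof.
pose w (u : R) : R := `|1 + u| `^ (- (1 + alpha)).
have [e [e0 ea e1]] : exists e : R, [/\ 0 < e, e < alpha & e < 1].
  exact: small_exponent.
have im : mellin_integrable w (0 - e) by apply: kernel_mellin_integrable; lra.
have ip : mellin_integrable w (0 + e) by apply: kernel_mellin_integrable; lra.
apply: (le_mellin_integrable im ip (c := c_minus alpha rho / e)) => //.
- by apply: measurable_funM => //; exact: measurable_ln.
- by move=> u; exact: powR_ge0.
- by rewrite divr_ge0// ltW.
move=> u u0; rewrite powRr0 mul1r normrM (ger0_norm (k0 u)).
have -> : k u = c_minus alpha rho * w u by rewrite /jump_density /w ger0_norm//; lra.
move: (c_minus alpha rho) (ltW c0) => c c_ge0.
rewrite -!mulrA ler_wpM2l//.
rewrite ler_pdivlMl// mulrCA [expR _ * _]mulrC ler_wpM2l ?powR_ge0//.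
by apply: le_trans (expR_ge1Dx _); rewrite lerDr.
Qed.

#[local] Opaque jump_density.

Lemma integral_phi_cst (r : \bar R) : (\int[phi]_(w in halfline) cst r w = r)%E.
Proof. by rewrite integral_cst// -[RHS]mule1; congr (_ * _)%E; exact: phi1. Qed.

Lemma resurrection_mass : (q halfline = (c_minus alpha rho / alpha)%:E)%E.
Proof.
have q1 := resurrection_integral_halfline phi alpha rho (@measurable_cst _ _ R _ setT 1%E) (fun=> lee01).
transitivity (\int[q]_(y in halfline) (cst 1 y))%E.
  by rewrite integral_cst// mul1e.
rewrite [LHS]q1 -integral_jump_density; apply: eq_integral => u _.
transitivity ((k u)%:E * \int[phi]_(w in halfline) cst 1 w)%E => //.
by rewrite integral_phi_cst mule1.
Qed.

Lemma ln_dilation u w : 0 < u -> w \in halfline -> ln (u * w) = ln u + ln w :> R.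
Proof. by move=> u0 /halflineP w0; rewrite lnM ?posrE. Qed.

Let mln : measurable_fun [set: R] (fun y : R => `|ln y|%:E).
Proof.
apply/measurable_EFinP; apply: measurableT_comp => //; exact: measurable_ln.
Qed.

Let mlnu u : measurable_fun [set: R] (fun w : R => `|ln (u * w)|%:E).
Proof. by apply: (measurableT_comp mln); exact: mulrl_measurable. Qed.

Let I : (mu.-integrable halfline (EFin \o (fun u => k u * `|ln u|))).
Proof.
have := integrable_norm integrable_jump_density_ln.
apply: eq_integrable => // u _.
by rewrite /= normrM (ger0_norm (k0 u)).
Qed.

(** The bounds |ln w| <= |ln (u w)| + |ln u| and |ln (u w)| <= |ln u| + |ln w| are
    integrated against the product of the jump density and phi, for which |ln u|
    has a finite integral. *)
Lemma resurrection_log_ltyP :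
  (\int[q]_(y in halfline) `|ln y|%:E < +oo <->
   \int[phi]_(y in halfline) `|ln y|%:E < +oo)%E.
Proof.
rewrite (resurrection_integral_halfline phi alpha rho mln (fun=> normr_ge0 _)).
set A := (\int[phi]_(y in _) _)%E.
have A0 : (0 <= A)%E by apply: integral_ge0.
have L1 : (\int[mu]_(u in halfline) (k u * `|ln u|)%:E < +oo)%E.
  exact: (@integrable_lty _ _ _ mu halfline mD _ I).
have m1 : measurable_fun halfline (fun u => (k u * `|ln u|)%:E).
  apply: measurable_funTS; apply/measurable_EFinP; apply: measurable_funM => //.
  apply: measurableT_comp => //; exact: measurable_ln.
have kE : measurable_fun halfline (fun u => (k u)%:E).
  by apply: measurable_funTS; exact/measurable_EFinP.
have mG : measurable_fun halfline (fun u => (k u)%:E * \int[phi]_(w in halfline) `|ln (u * w)|%:E)%E.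
  apply: emeasurable_funM => //; apply: measurable_funTS.
  exact: (measurable_dilation_section phi mln (fun=> normr_ge0 _)).
split => [Q|Afin].
  have : (((c_minus alpha rho / alpha)%:E * A) < +oo)%E.
    have -> : ((c_minus alpha rho / alpha)%:E * A =
        \int[mu]_(u in halfline) ((k u)%:E * A))%E.
      rewrite ge0_integralZr//; first by rewrite integral_jump_density.
      by move=> u _; rewrite lee_fin.
    apply: (@le_lt_trans _ _ (\int[mu]_(u in halfline)
        ((k u)%:E * \int[phi]_(w in halfline) `|ln (u * w)|%:E + (k u * `|ln u|)%:E))%E).
      apply: ge0_le_integral => //.
      - by move=> u _; rewrite mule_ge0// lee_fin.
      - by apply: emeasurable_funM.
      - by apply: emeasurable_funD.
      move=> u /mem_set/halflineP u0.
      rewrite (EFinM (k u)) -ge0_muleDr ?lee_fin//; last by apply: integral_ge0.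
      apply: lee_wpmul2l; first by rewrite lee_fin.
      have -> : (`|ln u|%:E = \int[phi]_(w in halfline) (cst `|ln u|%:E w))%E.
        by rewrite integral_phi_cst.
      rewrite -ge0_integralD//;
        [|by apply: measurable_funTS; exact: mlnu|by move=> w _; rewrite /= lee_fin].
      apply: ge0_le_integral => //.
      - by apply: measurable_funTS.
      - by apply: emeasurable_funD => //; apply: measurable_funTS; exact: mlnu.
      move=> w /mem_set w0; rewrite -EFinD lee_fin (ln_dilation u0 w0).
      by rewrite -[X in `|X| <= _](addKr (ln u)) addrC (le_trans (ler_normB _ _))// addrC.
    rewrite ge0_integralD//.
    - by apply: lte_add_pinfty.
    - by move=> u _; rewrite mule_ge0 ?lee_fin//; apply: integral_ge0.
    - by move=> u _; rewrite lee_fin mulr_ge0.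
  case: A A0 => [r _ _|_|//]; first by rewrite ltry.
  by rewrite gt0_muley// lte_fin divr_gt0.
apply: (@le_lt_trans _ _ (\int[mu]_(u in halfline)
    ((k u * `|ln u|)%:E + (k u)%:E * A))%E).
  apply: ge0_le_integral => //.
  - by move=> u _; rewrite mule_ge0 ?lee_fin//; apply: integral_ge0.
  - by apply: emeasurable_funD => //; apply: emeasurable_funM.
  move=> u /mem_set/halflineP u0.
  rewrite (EFinM (k u)) -ge0_muleDr ?lee_fin//.
  apply: lee_wpmul2l; first by rewrite lee_fin.
  have -> : (`|ln u|%:E = \int[phi]_(w in halfline) (cst `|ln u|%:E w))%E.
    by rewrite integral_phi_cst.
  rewrite -ge0_integralD//;
    [|by move=> w _; rewrite /= lee_fin|by apply: measurable_funTS].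
  apply: ge0_le_integral => //.
  - by apply: measurable_funTS; exact: mlnu.
  - by apply: emeasurable_funD => //; apply: measurable_funTS.
  move=> w /mem_set w0; rewrite -EFinD lee_fin (ln_dilation u0 w0).
  exact: ler_normD.
rewrite ge0_integralD//.
- apply: lte_add_pinfty => //.
  rewrite ge0_integralZr//; last by move=> u _; rewrite lee_fin.
  by rewrite integral_jump_density lte_mul_pinfty// lee_fin divr_ge0// ltW.
- by move=> u _; rewrite lee_fin mulr_ge0.
- by move=> u _; rewrite mule_ge0// lee_fin.
- by apply: emeasurable_funM.
Qed.

Lemma resurrection_Rintegral (f : R -> R) : measurable_fun [set: R] f ->
  (forall y, 0 <= f y) ->
  (\int[q]_(y in halfline) (f y)%:E < +oo)%E ->
  (forall u, 0 < u -> phi.-integrable halfline (EFin \o (fun w => f (u * w)))) ->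
  mu.-integrable halfline (EFin \o (fun u => k u * \int[phi]_(w in halfline) f (u * w))) /\
  \int[q]_(y in halfline) f y =
  \int[mu]_(u in halfline) (k u * \int[phi]_(w in halfline) f (u * w)).
Proof.
move=> mf f0 qf iu.
have mfE : measurable_fun [set: R] (EFin \o f) by exact/measurable_EFinP.
have e : (\int[q]_(y in halfline) (f y)%:E = \int[mu]_(u in halfline)
    (k u * \int[phi]_(w in halfline) f (u * w))%:E)%E.
  rewrite (resurrection_integral_halfline phi alpha rho mfE) => [|y]; last first.
    by rewrite lee_fin.
  apply: eq_integral => u /halflineP u0; rewrite (EFinM (k u)); congr (_ * _)%E.
  rewrite /Rintegral fineK//.
  exact: (@integrable_fin_num _ _ _ phi halfline mD _ (iu u u0)).
split; last by rewrite /Rintegral e.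
apply/integrableP; split.
  apply/measurable_EFinP; apply: measurable_funM; first exact: measurable_funTS.
  apply: measurable_funTS.
  apply: (measurableT_comp (fine_measurable measurableT)).
  by apply: (measurable_dilation_section phi mfE) => y; rewrite lee_fin.
under eq_integral => u _.
  rewrite /= ger0_norm; last by rewrite mulr_ge0// Rintegral_ge0.
  over.
by rewrite -e.
Qed.

(** The identity for nonnegative functions is applied to ln + |ln| and to |ln|,
    whose difference is ln. *)
Lemma resurrection_ln_mean :
  (\int[phi]_(y in halfline) `|ln y|%:E < +oo)%E ->
  \int[q]_(y in halfline) ln y =
  \int[mu]_(u in halfline) (k u * ln u) +
  c_minus alpha rho / alpha * \int[phi]_(y in halfline) ln y.
Proof.
move=> Afin.
have mlnR : measurable_fun [set: R] (@ln R) by exact: measurable_ln.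
have i1 : phi.-integrable halfline (EFin \o (@ln R)).
  by apply/integrableP; split => //; apply: measurable_funTS; exact/measurable_EFinP.
have iq1 : q.-integrable halfline (EFin \o (@ln R)).
  apply/integrableP; split; first by apply: measurable_funTS; exact/measurable_EFinP.
  exact/resurrection_log_ltyP.
have ic (r : R) : phi.-integrable halfline (EFin \o (fun=> r)).
  apply/integrableP; split; first exact: measurable_cst.
  by rewrite (integral_phi_cst `|r|%:E) ltry.
have iu u : 0 < u -> phi.-integrable halfline (EFin \o (fun w => ln (u * w))).
  move=> u0; have := integrableD _ (ic (ln u)) i1.
  move=> /(_ mD); apply: eq_integrable => // w wD.
  by rewrite /= (ln_dilation u0 wD) EFinD.
pose f y : R := ln y + `|ln y|.
pose g y : R := `|ln y|.
have mg : measurable_fun [set: R] g by exact: measurableT_comp.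
have mf : measurable_fun [set: R] f by exact: measurable_funD.
have g0 y : 0 <= g y by exact: normr_ge0.
have f0 y : 0 <= f y by rewrite /f -lerBlDl sub0r ler_normr lexx orbT.
have iqg : q.-integrable halfline (EFin \o g) by exact: integrable_norm.
have iqf : q.-integrable halfline (EFin \o f) by exact: (integrableD _ iq1 iqg).
have iug u : 0 < u -> phi.-integrable halfline (EFin \o (fun w => g (u * w))).
  by move=> u0; exact: (integrable_norm (iu u u0)).
have iuf u : 0 < u -> phi.-integrable halfline (EFin \o (fun w => f (u * w))).
  by move=> u0; exact: (integrableD _ (iu u u0) (iug u u0)).
have [kg eg] := resurrection_Rintegral mg g0 (integrable_lty mDR iqg) iug.
have [kf ef] := resurrection_Rintegral mf f0 (integrable_lty mDR iqf) iuf.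
transitivity (\int[q]_(y in halfline) f y - \int[q]_(y in halfline) g y).
  rewrite -RintegralB//.
  by apply: eq_Rintegral => y _; rewrite /f /g addrK.
rewrite ef eg -RintegralB//.
rewrite -[c_minus alpha rho / alpha](_ : \int[mu]_(u in halfline) k u = _); last first.
  by rewrite /Rintegral integral_jump_density.
rewrite -RintegralZr//; last exact: integrable_jump_density.
rewrite -RintegralD//; [|exact: integrable_jump_density_ln|]; last first.
  have := integrableZl mDR (\int[phi]_(y in halfline) ln y) integrable_jump_density.
  by apply: eq_integrable => // u _; rewrite /= mulrC.
apply: eq_Rintegral => u /halflineP u0; rewrite -mulrBr -mulrDr; congr (_ * _).
rewrite -RintegralB//; [|exact: iuf|exact: iug].
transitivity (\int[phi]_(w in halfline) (ln u + ln w)).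
  apply: eq_Rintegral => w w0; rewrite /f /g addrK.
  exact: ln_dilation.
rewrite RintegralD//; congr (_ + _).
by rewrite /Rintegral (integral_phi_cst (ln u)%:E).
Qed.

End log_moment.

(** * From the exponent to the first moment *)

Section exponent_bounds.
Context {R : realType}.
Implicit Types u v g p m k : R.

Lemma onem_expR_cos_le u v k : - k <= u ->
  1 - expR (- u) * cos v <= u + expR k * (v ^+ 2 / 2).
Proof.
move=> ku; have e1 := expR_ge1Dx (- u).
have ek : expR (- u) <= expR k by rewrite ler_expR lerNl.
have : expR (- u) * (1 - cos v) <= expR k * (v ^+ 2 / 2).
  by apply: ler_pM; rewrite ?expR_ge0 ?onem_cos_ge0 ?onem_cos_le.
rewrite mulrBr mulr1; move: (expR (- u) * cos v) => z; lra.
Qed.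

(** If the characteristic function is close to 1 then e^(- (g + p)) is bounded below
    and g + p is at most twice the defect; otherwise the defect is at least 1/2
    and the trivial bound p <= 2 m is enough. *)
Lemma le_onem_expR_cos g p v m : 0 <= p <= 2 * m ->
  0 <= 1 - expR (- (g + p)) * cos v ->
  p <= (2 + 4 * m) * (1 - expR (- (g + p)) * cos v) + `|g|.
Proof.
move=> /andP[p0 pm]; set s := 1 - _ => s0.
have m0 : 0 <= m by lra.
have g0 : 0 <= `|g| by [].
have [s2|s2] := leP s (1 / 2); last first.
  have : m * (1 / 2) <= m * s by rewrite ler_wpM2l// ltW.
  by rewrite [(2 + _) * s]mulrDl -[4 * m * s]mulrA; lra.
have ms : 0 <= m * s by rewrite mulr_ge0.
suff gps : g + p <= 2 * s.
  rewrite [(2 + _) * s]mulrDl -[4 * m * s]mulrA.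
  by have := ler_norm (- g); rewrite normrN; lra.
have [gp|gp] := leP (g + p) 0; first lra.
have es : 1 - s <= expR (- (g + p)).
  by rewrite /s subKr ler_piMr ?expR_ge0// cos_le1.
have e1 := expR_ge1Dx (g + p).
have : (1 + (g + p)) * (1 - s) <= expR (g + p) * expR (- (g + p)).
  by apply: ler_pM => //; lra.
rewrite expRN divff ?gt_eqF ?expR_gt0//.
have : (g + p) * (1 / 2) <= (g + p) * (1 - s) by rewrite ler_wpM2l//; lra.
clearbody s; rewrite [(1 + _) * _]mulrDl mul1r.
by move: ((g + p) * (1 - s)) => z; lra.
Qed.

End exponent_bounds.

Section first_moment.
Context {R : realType}.
Context d1 (Omega : measurableType d1) (P : probability Omega R).
Variables (X : Omega -> R) (mX : measurable_fun [set: Omega] X).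
Context d2 (T : measurableType d2) (q : {measure set T -> \bar R}).
Variables (D : set T) (mD : measurable D) (qfin : (q D < +oo)%E).
Variables (Y : T -> R) (mY : measurable_fun D Y).
Variables (g h : R -> R) (c : R).

Local Notation CX := (cos_transform P setT (fun=> 1) X).
Local Notation SX := (sin_transform P setT (fun=> 1) X).
Local Notation CY := (cos_transform q D (fun=> 1) Y).
Local Notation SY := (sin_transform q D (fun=> 1) Y).

(** Real and imaginary parts of a characteristic exponent of the form
    g + i h + int (1 - exp (i y Y)) dq: g and h are the smooth part and Y carries the
    jumps. *)
Definition exponent_re y := g y + (CY 0 - CY y).
Definition exponent_im y := h y - SY y.

Hypothesis gO : bigO_at0 2 g.
Hypothesis hO : bigO_at0 2 (fun y => h y - c * y).
Hypothesis CXE : forall y, CX y = expR (- exponent_re y) * cos (exponent_im y).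
Hypothesis SXE : forall y, SX y = - (expR (- exponent_re y) * sin (exponent_im y)).

Let Pfin : (P setT < +oo)%E. Proof. by rewrite probability_setT ltry. Qed.

Let mT : measurable [set: Omega]. Proof. by []. Qed.

Let CX0 : CX 0 = 1.
Proof.
rewrite cos_transform0 Rintegral_cst// mul1r.
exact: (congr1 fine (probability_setT P)).
Qed.

Let onem_CX_ge0 y : 0 <= 1 - CX y.
Proof.
have -> : 1 - CX y = CX 0 - CX y by rewrite CX0.
rewrite (cos_transform_onem mT Pfin y mX).
by apply: Rintegral_ge0 => w _; exact: onem_cos_ge0.
Qed.

Let onem_CY_bounds y : 0 <= CY 0 - CY y <= 2 * CY 0.
Proof.
rewrite (cos_transform_onem mD qfin y mY); apply/andP; split.
  by apply: Rintegral_ge0 => w _; exact: onem_cos_ge0.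
have i1 := integrable_one mD qfin.
rewrite cos_transform0 -RintegralZl//; apply: le_Rintegral => //.
- exact: integrable_onem_cos.
- exact: (integrableZl mD 2 i1).
by move=> t _; have := cos_geN1 (y * Y t); lra.
Qed.

(** The defect of the transform of Y is bounded by a multiple of that of X, up to
    O(y^2). *)
Lemma jump_integrable_of_mean : P.-integrable setT (EFin \o X) ->
  q.-integrable D (EFin \o Y).
Proof.
move=> iX; have [K [e [K0 e0 e1 gK]]] := gO.
apply: (integrable_of_dyadic_bounded mD qfin e0 mY).
have CY0 : 0 <= CY 0 by rewrite cos_transform0; exact: Rintegral_ge0.
have B := dyadic_bounded_of_integrable mT Pfin e mX iX.
apply: (dyadic_bounded_le e0 (K := 2 + 4 * CY 0) (L := K) _ K0 _ B); first lra.
move=> y /andP[y0 ye].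
have := onem_CX_ge0 y; rewrite CX0 CXE => s0.
apply: (le_trans (le_onem_expR_cos (onem_CY_bounds y) s0)).
rewrite lerD2l; have := gK y; rewrite gtr0_norm//.
exact.
Qed.

(** The defect of X is at most the real part of the exponent plus a multiple of the
    square of its imaginary part; the latter is O(y), because Y is integrable. *)
Lemma mean_of_jump_integrable : q.-integrable D (EFin \o Y) ->
  P.-integrable setT (EFin \o X).
Proof.
move=> iY; have [K [e [K0 e0 e1 gK]]] := gO.
have [L [e' [L0 e'0 e'1 hL]]] := hO.
pose M := \int[q]_(t in D) `|Y t|.
have M0 : 0 <= M by exact: Rintegral_ge0.
pose r := Num.min e e'.
have r0 : 0 < r by rewrite lt_min e0.
apply: (integrable_of_dyadic_bounded mT Pfin r0 mX).
have B := dyadic_bounded_of_integrable mD qfin r mY iY.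
pose N := L + `|c| + M.
have N0 : 0 <= N by rewrite !addr_ge0.
apply: (dyadic_bounded_le r0 (K := 1) (L := K + expR K * (N ^+ 2 / 2)) _ _ _ B) => //.
  by rewrite addr_ge0// mulr_ge0 ?expR_ge0// divr_ge0// sqr_ge0.
move=> y /andP[y0]; rewrite le_min => /andP[ye ye'].
have ny : `|y| = y by rewrite gtr0_norm.
have y1 : y <= 1 by apply: le_trans e1.
have y2 : y ^+ 2 <= 1 by rewrite exprn_ile1// ltW.
have gy : `|g y| <= K * y ^+ 2 by have := gK y; rewrite ny; exact.
have hy : `|h y - c * y| <= L * y ^+ 2 by have := hL y; rewrite ny; exact.
have Sy : `|SY y| <= y * M by have := norm_sin_transform_le mD qfin y mY iY; rewrite ny.
have py := onem_CY_bounds y; have /andP[p0 _] := py.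
have Ky : K * y ^+ 2 <= K by rewrite ler_piMr.
have uK : - K <= exponent_re y.
  by rewrite /exponent_re; have := ler_norm (- g y); rewrite normrN; lra.
have vN : `|exponent_im y| <= N * y.
  rewrite /exponent_im -[h y](subrK (c * y)) -addrA.
  apply: (le_trans (ler_normD _ _)); rewrite /N !mulrDl -addrA lerD//.
    apply: (le_trans hy); rewrite ler_wpM2l// expr2 ler_piMl//; exact: ltW.
  by apply: (le_trans (ler_normB _ _)); rewrite normrM ny lerD// mulrC.
rewrite CX0 CXE mul1r; apply: (le_trans (onem_expR_cos_le _ uK)).
have v2 : exponent_im y ^+ 2 <= N ^+ 2 * y ^+ 2.
  by rewrite -exprMn -real_normK ?num_real// lerXn2r ?nnegrE// mulr_ge0// ltW.
have : expR K * (exponent_im y ^+ 2 / 2) <= expR K * (N ^+ 2 / 2) * y ^+ 2.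
  rewrite -[leRHS]mulrA ler_wpM2l ?expR_ge0//.
  by rewrite [leRHS]mulrAC ler_wpM2r.
rewrite mulrDl /exponent_re; have := ler_norm (g y).
move: (expR K * _) => z1; move: (expR K * _) => z2; lra.
Qed.

Let exponent0 : exponent_re 0 = 0 /\ exponent_im 0 = 0.
Proof.
have [K [e [_ e0 _ gK]]] := gO; have [L [e' [_ e'0 _ hL]]] := hO.
have := gK 0; rewrite normr0 expr0n/= mulr0 normr_le0 => /(_ (ltW e0))/eqP g0.
have := hL 0; rewrite normr0 expr0n/= !mulr0 subr0 normr_le0 => /(_ (ltW e'0))/eqP h0.
by rewrite /exponent_re /exponent_im g0 h0 subrr sin_transform0// subr0 addr0.
Qed.

Lemma is_derive_exponent_re : q.-integrable D (EFin \o Y) ->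
  is_derive (0 : R) (1 : R) exponent_re 0.
Proof.
move=> iY; have dC := is_derive_cos_transform mD qfin mY iY.
have dg : is_derive (0 : R) (1 : R) g 0.
  apply: (@bigO_at0_is_derive _ g 0 0).
  by apply: eq_bigO_at0 gO => y /=; rewrite mul0r !subr0.
have -> : exponent_re = g + (cst (CY 0) - CY) by apply/funext.
by apply: (is_derive_eq (is_deriveD dg (is_deriveB (is_derive_cst (CY 0) (0 : R) (1 : R)) dC)));
  rewrite subr0 addr0.
Qed.

Lemma is_derive_exponent_im : q.-integrable D (EFin \o Y) ->
  is_derive (0 : R) (1 : R) exponent_im (c - \int[q]_(t in D) Y t).
Proof.
move=> iY; have dS := is_derive_sin_transform mD qfin mY iY.
have dh : is_derive (0 : R) (1 : R) h c.
  apply: (@bigO_at0_is_derive _ h 0 c).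
  by apply: eq_bigO_at0 hO => y /=; rewrite subr0.
have -> : exponent_im = h - SY by apply/funext.
exact: is_deriveB.
Qed.

(** Both sides are minus the derivative at 0 of the imaginary part of the
    exponent: the sine transform of X is - exp (- exponent_re) sin exponent_im. *)
Lemma mean_eq : q.-integrable D (EFin \o Y) ->
  \int[P]_w X w = \int[q]_(t in D) Y t - c.
Proof.
move=> iY; have iX := mean_of_jump_integrable iY.
have dX := is_derive_sin_transform mT Pfin mX iX.
have du := is_derive_exponent_re iY; have dv := is_derive_exponent_im iY.
have [u0 v0] := exponent0.
apply: (is_derive_unique dX).
have -> : SX = - ((expR \o (- exponent_re)) * (sin \o exponent_im)).
  by apply/funext => y; rewrite SXE.
have dE : is_derive (0 : R) (1 : R) (expR \o (- exponent_re)) 0.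
  apply: (is_derive_eq (is_derive1_comp (is_derive_expR _) (is_deriveN du))).
  by rewrite oppr0 mulr0.
have dS : is_derive (0 : R) (1 : R) (sin \o exponent_im) (c - \int[q]_(t in D) Y t).
  apply: (is_derive_eq (is_derive1_comp (is_derive_sin _) dv)).
  by rewrite v0 cos0 mul1r.
apply: (is_derive_eq (is_deriveN (is_deriveM dE dS))).
have -> : (expR \o (- exponent_re)) 0 = 1.
  by rewrite -[LHS]/(expR (- exponent_re 0)) u0 oppr0 expR0.
by rewrite scaler0 addr0 scale1r opprB.
Qed.

End first_moment.

(** * The first moment of the process *)

Section exponent_assembly.
Context {R : realType}.
Implicit Types (alpha rho a : R).

(** Covers both the characteristic function of a random variable and the jump part
    of the exponent. *)
Lemma cintegral_cexp d (T : measurableType d) (m : {measure set T -> \bar R})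
    (D : set T) (Y : T -> R) (y : R) :
  cintegral m D (fun t => cexp (0 +i* (y * Y t))) =
  cos_transform m D (fun=> 1) Y y +i* sin_transform m D (fun=> 1) Y y.
Proof.
rewrite /cintegral /cos_transform /sin_transform; congr (_ +i* _);
  apply: eq_Rintegral => t _; rewrite /cexp ?ReM ?ImM /= expR0.
- by rewrite mul0r subr0.
- by rewrite mul0r addr0.
Qed.

Lemma ReB (z w : R[i]) : complex.Re (z - w) = complex.Re z - complex.Re w.
Proof. by case: z; case: w. Qed.

Lemma ImB (z w : R[i]) : complex.Im (z - w) = complex.Im z - complex.Im w.
Proof. by case: z; case: w. Qed.

Lemma cexpN (z : R[i]) : cexp (- z) =
  expR (- complex.Re z) * cos (complex.Im z) +i*
  - (expR (- complex.Re z) * sin (complex.Im z)).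
Proof.
case: z => x y; rewrite /cexp; apply/eqP; rewrite eq_complex; apply/andP; split.
  by rewrite ReM /= mul0r subr0 cosN.
by rewrite ImM /= mul0r addr0 sinN mulrN.
Qed.

Lemma phi_halfline (phi : probability (measurableTypeR R) R) :
  phi [set y | 0 <= y] = 1%E -> return_mass phi = 1 ->
  phi (`]0%R, +oo[%classic : set R) = 1%E.
Proof.
move=> p1 /eqP; rewrite subr_eq addrC -subr_eq subrr eq_sym => /eqP p0.
have {}p0 : phi [set 0] = 0%E.
  by rewrite -[LHS]fineK ?p0// fin_num_measure.
rewrite -p1 (_ : [set y | 0 <= y] = [set 0] `|` `]0%R, +oo[%classic); last first.
  apply/seteqP; split => [y /=|y [->|]]; rewrite /= ?in_itv/= ?andbT.
  - by rewrite le_eqVlt => /predU1P[<-|]; [left|right].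
  - by [].
  - exact: ltW.
rewrite measureU//; first by rewrite -[LHS]add0e; congr (_ + _)%E; rewrite -p0.
by apply/seteqP; split => // y [/= ->]; rewrite in_itv/= ltxx.
Qed.

Lemma integral_jump_density_ln alpha rho : 0 < alpha -> 0 < c_minus alpha rho ->
  \int[@lebesgue_measure R]_(u in `]0%R, +oo[) (jump_density alpha rho u * ln u) =
  c_minus alpha rho / alpha * (dGamma 1 - dGamma alpha / Gamma alpha).
Proof.
move=> a0 c0; have ik := integrable_jump_density_ln a0 c0.
have mD : measurable (`]0%R, +oo[%classic : set (measurableTypeR R)) by [].
pose f (u : R) : R := ln u * (1 + u) `^ (- (1 + alpha)).
have kE u : jump_density alpha rho u * ln u = c_minus alpha rho * f u.
  by rewrite /jump_density /f [ln u * _]mulrC mulrA.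
have iF : (@lebesgue_measure R).-integrable `]0%R, +oo[ (EFin \o f).
  have := integrableZl mD (c_minus alpha rho)^-1 ik.
  apply: eq_integrable => // u _.
  by rewrite /= kE -EFinM mulKf// gt_eqF.
under eq_Rintegral do rewrite kE.
rewrite RintegralZl// integral_kernel_ln// [1 + alpha]addrC GammaD1//.
have g0 := Gamma_gt0 a0.
rewrite -mulrA; congr (_ * _); rewrite invfM mulrCA; congr (_ * _).
by rewrite mulrBl mulfK// gt_eqF.
Qed.

End exponent_assembly.

Lemma expectation_norm_lty (R : realType) d (T : measurableType d)
    (P : probability T R) (X : {RV P >-> R}) :
  ('E_P[fun w => `|X w|%R] < +oo)%E <-> P.-integrable setT (EFin \o X).
Proof.
rewrite unlock; split => [Xoo|/integrableP[_]//].
by apply/integrableP; split => //; exact/measurable_EFinP.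
Qed.

Theorem theorem1p1 (R : realType) (alpha rho : R)
    (phi : probability (measurableTypeR R) R)
    (d : measure_display) (Omega : measurableType d) (P : probability Omega R)
    (xi : R -> {RV P >-> R})
    (alpha_rho : permissible alpha rho)
    (phi_carrier : phi [set y | 0 <= y] = 1%E)
    (xi_levy : levy_process xi)
    (xi_exponent : forall t theta : R, 0 <= t ->
       char_fun (xi t) theta = cexp (- (t%:C * Psi_bar phi alpha rho theta)))
    (phi_mass : return_mass phi = 1) :
  (('E_P[fun w => `|xi 1%R w|%R] < +oo)%E <->
     (\int[phi]_(y in `]0%R, +oo[) `|ln y|%:E < +oo)%E) /\
  (('E_P[fun w => `|xi 1%R w|%R] < +oo)%E ->
     [/\ cderivable (Psi_bar phi alpha rho) 0,
         (fine 'E_P[xi 1])%:C = 'i%C * cderive1 (Psi_bar phi alpha rho) 0 &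
         ('E_P[xi 1%R])%E =
           (Gamma alpha * (sin (pi * alpha * rho_hat rho) / pi) *
             (pi * cot (pi * alpha * rho_hat rho) +
                \int[phi]_(y in `]0, +oo[) ln y))%:E]).
Proof.
have [a0 a01] := permissible_bounds alpha_rho.
have c0 := c_minus_gt0 a0 a01.
have phi1 := phi_halfline phi_carrier phi_mass.
rewrite -[pi * alpha * _]mulrA.
set a := alpha * rho_hat rho in a01 *.
pose q := resurrection_kernel phi alpha rho 1.
pose D : set (measurableTypeR R) := `]0%R, +oo[%classic.
have mD : measurable D by exact: (measurable_itv `]0%R, +oo[).
have qD : q D = (c_minus alpha rho / alpha)%:E by exact: resurrection_mass.
have qfin : (q D < +oo)%E by rewrite qD ltry.
have mln : measurable_fun D (@ln R) by apply: measurable_funTS; exact: measurable_ln.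
pose G (y : R) : R[i] := cGamma (alpha -i* y) / cGamma (a -i* y) *
  (cGamma (1 +i* y) / cGamma ((1 - a) +i* y)).
set r := c_minus alpha rho / alpha in qD.
have rE : Gamma alpha / (Gamma a * Gamma (1 - a)) = r by rewrite /r c_minus_div.
pose c := r * (dGamma 1 - dGamma alpha / Gamma alpha - pi * cot (pi * a)).
have [GRe GIm] : expands G r c.
  by have := expands_Gamma_ratio a0 a01; rewrite rE.
pose g y := complex.Re (G y) - r.
pose h y := complex.Im (G y).
pose u := exponent_re q D (@ln R) g.
pose v := exponent_im q D (@ln R) h.
have C0 : cos_transform q D (fun=> 1) (@ln R) 0 = r.
  by rewrite cos_transform0 Rintegral_cst// mul1r; exact: (congr1 fine qD).
have PsiRe : (fun y => complex.Re (Psi_bar phi alpha rho y)) = u.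
  apply/funext => y; rewrite /Psi_bar ReB cintegral_cexp /= /u /exponent_re C0.
  by rewrite addrA subrK.
have PsiIm : (fun y => complex.Im (Psi_bar phi alpha rho y)) = v.
  by apply/funext => y; rewrite /Psi_bar ImB cintegral_cexp.
have X1 y : cos_transform P setT (fun=> 1) (xi 1) y +i*
    sin_transform P setT (fun=> 1) (xi 1) y =
    expR (- u y) * cos (v y) +i* - (expR (- u y) * sin (v y)).
  rewrite -cintegral_cexp -PsiRe -PsiIm -cexpN.
  by have := xi_exponent 1 y ler01; rewrite mul1r.
have CX y : cos_transform P setT (fun=> 1) (xi 1) y = expR (- u y) * cos (v y).
  by have [] := X1 y.
have SX y : sin_transform P setT (fun=> 1) (xi 1) y = - (expR (- u y) * sin (v y)).
  by have [] := X1 y.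
have mX : measurable_fun setT (xi 1) by [].
have iff : ('E_P[fun w => `|xi 1%R w|%R] < +oo)%E <-> q.-integrable D (EFin \o (@ln R)).
  rewrite expectation_norm_lty; split.
    exact: (jump_integrable_of_mean mX mD qfin mln GRe CX).
  exact: (mean_of_jump_integrable mX mD qfin mln GRe GIm CX).
have qphi : q.-integrable D (EFin \o (@ln R)) <->
    (\int[phi]_(y in `]0%R, +oo[) `|ln y|%:E < +oo)%E.
  rewrite -(resurrection_log_ltyP a0 c0 phi1); split => [/integrableP[]//|h1].
  by apply/integrableP; split => //; exact/measurable_EFinP.
split; first by rewrite iff.
move=> /[dup] /expectation_norm_lty iX /iff iq.
have [du dv] : is_derive (0 : R) (1 : R) u 0 /\
    is_derive (0 : R) (1 : R) v (c - \int[q]_(y in D) ln y).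
  split.
    exact: (is_derive_exponent_re mD qfin mln GRe).
  exact: (is_derive_exponent_im mD qfin mln GIm).
have mean : \int[P]_w xi 1 w = \int[q]_(y in D) ln y - c.
  exact: (mean_eq mX mD qfin mln GRe GIm CX SX).
have EX : ('E_P[xi 1%R] = (\int[P]_w xi 1 w)%R%:E)%E.
  by rewrite unlock /Rintegral fineK//; exact: integrable_fin_num.
split.
- by split; rewrite ?PsiRe ?PsiIm; exact: ex_derive.
- rewrite EX /= mean /cderive1 PsiRe PsiIm !derive1E !derive_val.
  by apply/eqP; rewrite eq_complex /= !mul0r !mul1r sub0r addr0 opprB !eqxx.
rewrite EX mean; congr (_%:E).
rewrite (resurrection_ln_mean a0 c0 phi1 (proj1 qphi iq)) integral_jump_density_ln// -/r.
rewrite -Gamma_ratio_sin// rE /c.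
move: (\int[phi]_(y in _) ln y) (pi * cot _) (dGamma 1 - _) => x y z; ring.
Qed.
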